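(* Let $A$ be a left-noetherian ring that satisfies condition (AC), and let $M$ be a complex of left $A$-modules. If $M$ has bounded and degreewise finitely generated homology, and $\mathbf{R}\mathrm{Hom}_A(M,M\oplus A)$ is homologically bounded, then $M$ has finite projective dimension given by $$\operatorname{pd}_A M=-\inf \mathbf{R}\mathrm{Hom}_A(M,A)<\infty .$$
   Context: A left-noetherian ring $A$ satisfies condition (AC) if for every finitely generated left $A$-module $M$ there exists an integer $b_M\geq 0$ such that for every finitely generated left $A$-module $N$ one has: if $\operatorname{Ext}_A^{i}(M,N)=0$ for all $i\gg 0$, then $\operatorname{Ext}_A^{i}(M,N)=0$ for all $i>b_M$. Complexes are graded homologically, $\cdots\to M_{v+1}\to M_v\to M_{v-1}\to\cdots$. A complex $M$ is homologically bounded if $\mathrm H_v(M)=0$ for $|v|\gg0$, and $\inf M$ denotes the infimum of $\{v\in\mathbb Z : \mathrm H_v(M)\neq 0\}$, with $\inf\varnothing=\infty$. Derived Hom satisfies $\mathrm H_{-i}(\mathbf{R}\mathrm{Hom}_A(M,N))\cong\operatorname{Ext}^i_A(M,N)$ for modules $M,N$. The projective dimension of a homologically right-bounded complex $M$ (i.e. $\mathrm H_v(M)=0$ for $v\ll0$) is $\operatorname{pd}_A M=\inf\{\sup\{i\in\mathbb Z : P_i\neq 0\} : P \text{ is a projective resolution of } M\}$, with $\sup\varnothing=-\infty$; in particular the zero object has projective dimension $-\infty$, and ''finite'' here means $<\infty$. *)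

(* Defs.v *)
From HB Require Import structures.
From mathcomp Require Import all_boot all_order all_algebra.
From mathcomp Require Import mathcomp_extra boolp classical_sets functions.
From mathcomp Require Import constructive_ereal.

Set Implicit Arguments.
Unset Strict Implicit.
Unset Printing Implicit Defensive.

Import Order.TTheory GRing.Theory Num.Theory.
Local Open Scope ring_scope.
Local Open Scope quotient_scope.

Definition left_ideal (A : pzRingType) (I : set A) : Prop :=
  [/\ I 0, forall x y, I x -> I y -> I (x + y)
    & forall a x, I x -> I (a * x)].

Definition left_noetherian (A : pzRingType) : Prop :=
  forall I : set A, left_ideal I ->
  exists n (g : 'I_n -> A),
    I = [set x | exists c : 'I_n -> A, x = \sum_(k < n) c k * g k]%classic.

Definition fin_gen (A : pzRingType) (V : lmodType A) : Prop :=
  exists n (g : 'I_n -> V),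
    forall x, exists c : 'I_n -> A, x = \sum_(k < n) c k *: g k.

Definition is_zero (A : pzRingType) (V : lmodType A) : Prop :=
  forall x : V, x = 0.

Definition projective (A : pzRingType) (P : lmodType A) : Prop :=
  forall (U V : lmodType A) (g : {linear U -> V}) (h : {linear P -> V}),
    (forall v, exists u, g u = v) ->
    exists k : {linear P -> U}, forall x, g (k x) = h x.


(* Complexes are graded homologically.  The differential is a family indexed by
   all pairs of degrees and vanishing off the pairs (i + 1, i); this avoids
   transporting elements along equalities between degrees. *)
Record complex (R : pzRingType) := Complex {
  obj :> int -> lmodType R;
  diff : forall i j, {linear obj i -> obj j};
  diff_shape : forall i j, i != j + 1 -> forall x, diff i j x = 0;
  diffK : forall i j k x, diff j k (diff i j x) = 0
}.

Section Homology.
Variables (R : pzRingType) (X : complex R) (v : int).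

Definition cycle_pred : {pred X v} := fun x => diff X v (v - 1) x == 0.

Fact cycle_pred_submod : subsemimod_closed cycle_pred.
Proof.
split; first split.
- by rewrite unfold_in linear0.
- by move=> x y; rewrite !unfold_in linearD => /eqP-> /eqP->; rewrite addr0.
- by move=> a x; rewrite !unfold_in linearZ_LR => /eqP->; rewrite scaler0.
Qed.
HB.instance Definition _ :=
  GRing.isSubmodClosed.Build R (X v) cycle_pred cycle_pred_submod.

Record cycles := Cycles { cycle_val : X v; _ : cycle_val \in cycle_pred }.
HB.instance Definition _ := [isSub for cycle_val].
HB.instance Definition _ := [Choice of cycles by <:].
HB.instance Definition _ := [SubChoice_isSubLmodule of cycles by <:].

Definition boundary : {pred cycles} :=
  fun z => `[< exists y, diff X (v + 1) v y = cycle_val z >].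

Fact boundary_submod : subsemimod_closed boundary.
Proof.
split; first split.
- by apply/asboolP; exists 0; rewrite linear0.
- move=> x y /asboolP[x' ex] /asboolP[y' ey]; apply/asboolP.
  by exists (x' + y'); rewrite linearD ex ey.
- move=> a x /asboolP[x' ex]; apply/asboolP.
  by exists (a *: x'); rewrite linearZ_LR ex.
Qed.
HB.instance Definition _ :=
  GRing.isSubmodClosed.Build R cycles boundary boundary_submod.

Definition homology : Type := Quotient.quot boundary.
HB.instance Definition _ := GRing.Zmodule.on homology.
HB.instance Definition _ := EqQuotient.on homology.

Definition homology_class (z : cycles) : homology := \pi_(Quotient.quot boundary) z.

Definition homology_scale (a : R) (h : homology) : homology :=
  homology_class (a *: repr h).

Fact homology_classK (h : homology) : homology_class (repr h) = h.
Proof. exact: reprK. Qed.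

Fact homology_classD (x y : cycles) :
  homology_class (x + y) = homology_class x + homology_class y.
Proof. exact: (@Quotient.pi_add _ boundary x y). Qed.

Fact homology_classZ a (z : cycles) :
  homology_class (a *: z) = homology_scale a (homology_class z).
Proof.
apply/eqP; rewrite -Quotient.idealrBE -scalerBr.
apply: rpredZ; rewrite Quotient.idealrBE; apply/eqP.
exact/esym/(reprK (homology_class z)).
Qed.

Fact homology_scaleA a b h :
  homology_scale a (homology_scale b h) = homology_scale (a * b) h.
Proof. by rewrite -(homology_classK h) -!homology_classZ scalerA. Qed.

Fact homology_scale1 : left_id 1 homology_scale.
Proof.
by move=> h; rewrite -(homology_classK h) -homology_classZ scale1r.
Qed.

Fact homology_scaleDr : right_distributive homology_scale +%R.
Proof.
move=> a g h; rewrite -(homology_classK g) -(homology_classK h).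
by rewrite -homology_classD -!homology_classZ scalerDr homology_classD.
Qed.

Fact homology_scaleDl h : {morph homology_scale^~ h : a b / a + b}.
Proof.
move=> a b; rewrite -(homology_classK h).
by rewrite -!homology_classZ scalerDl homology_classD.
Qed.

HB.instance Definition _ := GRing.Zmodule_isLmodule.Build R homology
  homology_scaleA homology_scale1 homology_scaleDr homology_scaleDl.

End Homology.

Section ChainMap.
Variables (R : pzRingType) (X Y : complex R).

Record chain_map := ChainMap {
  chain_fun :> forall i, {linear X i -> Y i};
  chain_funC : forall i j x,
    chain_fun j (diff X i j x) = diff Y i j (chain_fun i x)
}.

Fact cycle_map_subproof (f : chain_map) v (z : cycles X v) :
  f v (cycle_val z) \in @cycle_pred R Y v.
Proof.
case: z => z /= zc; rewrite unfold_in -chain_funC.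
by rewrite (eqP zc) linear0.
Qed.

Definition cycle_map (f : chain_map) v (z : cycles X v) : cycles Y v :=
  Cycles (cycle_map_subproof f z).

Definition homology_map (f : chain_map) v (h : homology X v) : homology Y v :=
  homology_class (cycle_map f (repr h)).

Definition quasi_iso (f : chain_map) : Prop :=
  forall v, bijective (@homology_map f v).

End ChainMap.

Section Stalk.
Variables (R : pzRingType) (V : lmodType R).

(* The module V as a complex concentrated in degree 0. *)
Definition stalk_obj (i : int) : lmodType R :=
  if i is Posz 0 then V else 'rV[R]_0.

Definition stalk : complex R :=
  @Complex R stalk_obj (fun i j => \0) (fun _ _ _ _ => erefl)
    (fun _ _ _ _ => erefl).

End Stalk.

Section DirectSum.
Variables (R : pzRingType) (X Y : complex R).

Definition dsum_obj (i : int) : lmodType R := (X i * Y i)%type.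

Definition dsum_diff_fun i j (x : dsum_obj i) : dsum_obj j :=
  (diff X i j x.1, diff Y i j x.2).

Fact dsum_diff_linear i j : linear (@dsum_diff_fun i j).
Proof.
by move=> a x y; rewrite /dsum_diff_fun !linearP.
Qed.
HB.instance Definition _ i j := GRing.isLinear.Build R
  (dsum_obj i) (dsum_obj j) *:%R (@dsum_diff_fun i j) (@dsum_diff_linear i j).

Definition dsum_diff i j : {linear dsum_obj i -> dsum_obj j} :=
  @dsum_diff_fun i j.

Fact dsum_diff_shape i j : i != j + 1 -> forall x, dsum_diff i j x = 0.
Proof. by move=> ij x; rewrite /= /dsum_diff_fun !diff_shape. Qed.

Fact dsum_diffK i j k x : dsum_diff j k (dsum_diff i j x) = 0.
Proof. by rewrite /= /dsum_diff_fun /= !diffK. Qed.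

Definition dsum : complex R := Complex dsum_diff_shape dsum_diffK.

End DirectSum.

Section HomComplex.
Variables (R : pzRingType) (X Y : complex R).

(* Homogeneous maps of degree n, i.e. the product over i of the groups
   Hom(X i, Y (i + n)): the component X i -> Y j is zero unless j = i + n. *)
Record hom (n : int) := Hom {
  hom_fun :> forall i j, X i -> Y j;
  hom_linear : forall i j, linear (@hom_fun i j);
  hom_degree : forall i j, j != i + n -> forall x, @hom_fun i j x = 0
}.

Fact homP n (f g : hom n) : (forall i j x, f i j x = g i j x) -> f = g.
Proof.
case: f g => [f fl fd] [g gl gd] /= fg.
have E : f = g by do 3![apply: functional_extensionality_dep => ?]; exact: fg.
case: _ / E in gl gd *.
by rewrite (Prop_irrelevance fl gl) (Prop_irrelevance fd gd).
Qed.

HB.instance Definition _ n := gen_eqMixin (hom n).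
HB.instance Definition _ n := gen_choiceMixin (hom n).

Section HomGroup.
Variable n : int.
Implicit Types f g : hom n.

Fact hom_zero_subproof :
  (forall i j, linear (fun _ : X i => 0 : Y j)) *
  (forall i j, j != i + n -> forall _ : X i, (0 : Y j) = 0).
Proof. by split=> // i j a x y; rewrite scaler0 addr0. Qed.
Definition hom_zero : hom n := Hom hom_zero_subproof.1 hom_zero_subproof.2.

Fact hom_add_linear f g i j : linear (fun x => f i j x + g i j x).
Proof.
by move=> a x y; rewrite !hom_linear scalerDr addrACA.
Qed.
Fact hom_add_degree f g i j :
  j != i + n -> forall x, f i j x + g i j x = 0.
Proof. by move=> ij x; rewrite !hom_degree // addr0. Qed.
Definition hom_add f g : hom n :=
  Hom (hom_add_linear f g) (@hom_add_degree f g).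

Fact hom_opp_linear f i j : linear (fun x => - f i j x).
Proof. by move=> a x y; rewrite hom_linear opprD scalerN. Qed.
Fact hom_opp_degree f i j : j != i + n -> forall x, - f i j x = 0.
Proof. by move=> ij x; rewrite hom_degree // oppr0. Qed.
Definition hom_opp f : hom n := Hom (hom_opp_linear f) (@hom_opp_degree f).

Fact hom_addA : associative hom_add.
Proof. by move=> f g h; apply: homP => i j x /=; rewrite addrA. Qed.
Fact hom_addC : commutative hom_add.
Proof. by move=> f g; apply: homP => i j x /=; rewrite addrC. Qed.
Fact hom_add0 : left_id hom_zero hom_add.
Proof. by move=> f; apply: homP => i j x /=; rewrite add0r. Qed.
Fact hom_addN : left_inverse hom_zero hom_opp hom_add.
Proof. by move=> f; apply: homP => i j x /=; rewrite addNr. Qed.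
HB.instance Definition _ :=
  GRing.isZmodule.Build (hom n) hom_addA hom_addC hom_add0 hom_addN.

End HomGroup.

(* For f of degree n, the component of the differential of f of degree n - 1 on
   X i is d_Y o f - (-1)^n f o d_X. *)
Section HomDiff.
Variables n m : int.

Definition hom_diff_val (f : hom n) i j (x : X i) : Y j :=
  if n == m + 1 then
    diff Y (i + n) j (f i (i + n) x)
      - (-1) ^+ `|n|%N *: f (i - 1) j (diff X i (i - 1) x)
  else 0.

Fact hom_diff_linear f i j : linear (fun x : X i => hom_diff_val f j x).
Proof.
move=> a x y; rewrite /hom_diff_val; case: ifP => _; last first.
  by rewrite scaler0 addr0.
rewrite hom_linear 2!linearP hom_linear scalerDr opprD addrACA scalerBr.
congr (_ - _ + _); rewrite !scalerA; congr (_ *: _).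
by rewrite -signr_odd; case: odd; rewrite ?mul1r ?mulr1 ?mulN1r ?mulrN1.
Qed.

Fact hom_diff_degree f i j :
  j != i + m -> forall x : X i, hom_diff_val f j x = 0.
Proof.
move=> ij x; rewrite /hom_diff_val; case: ifP => // /eqP En.
rewrite diff_shape ?hom_degree ?scaler0 ?subr0 //.
- by rewrite En [m + 1]addrC addrA subrK.
- by rewrite En addrA (inj_eq (addIr 1)) eq_sym.
Qed.

Definition hom_diff_fun (f : zmodule (hom n)) : zmodule (hom m) :=
  Hom (hom_diff_linear f) (@hom_diff_degree f).

Fact hom_diff_additive (f g : hom n) :
  hom_diff_fun (f - g) = hom_diff_fun f - hom_diff_fun g.
Proof.
apply: homP => i j x /=; rewrite /hom_diff_val; case: ifP => _ /=.
  by rewrite linearB scalerBr opprD addrACA -opprD.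
by rewrite subr0.
Qed.

Fact hom_diff_scalable (a : int) (f : zmodule (hom n)) :
  hom_diff_fun (a *: f) = a *: hom_diff_fun f.
Proof.
pose h := GRing.isZmodMorphism.Build (hom n) (hom m) hom_diff_fun
  hom_diff_additive.
pose hm : {additive hom n -> hom m} := HB.pack (hom_diff_fun : hom n -> hom m) h.
exact: (raddfMz hm a f).
Qed.

HB.instance Definition _ := GRing.isZmodMorphism.Build
  (zmodule (hom n)) (zmodule (hom m)) hom_diff_fun hom_diff_additive.
HB.instance Definition _ := GRing.isScalable.Build int
  (zmodule (hom n)) (zmodule (hom m)) *:%R hom_diff_fun hom_diff_scalable.

End HomDiff.

Definition hom_diff n m : {linear zmodule (hom n) -> zmodule (hom m)} :=
  @hom_diff_fun n m.

Fact hom_diff_shape n m :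
  n != m + 1 -> forall f, hom_diff n m f = 0.
Proof.
move=> /negPf nm f; apply: homP => i j x /=.
by rewrite /hom_diff_val nm.
Qed.

Fact sign_succz (k : int) : (-1) ^+ absz (k + 1) = - (-1) ^+ absz k :> R.
Proof.
case: k => k; first by rewrite -PoszD absz_nat addn1 exprS mulN1r.
have -> : Negz k + 1 = - k%:Z by rewrite NegzE -[k.+1]addn1 PoszD opprD subrK.
by rewrite abszN absz_nat /= exprS mulN1r opprK.
Qed.

Fact hom_diffK n m p f : hom_diff m p (hom_diff n m f) = 0.
Proof.
apply: homP => i j x /=; rewrite /hom_diff_fun /hom_diff_val /= /hom_diff_val.
have [Em|//] := eqVneq m (p + 1); have [En|_] := eqVneq n (m + 1); last first.
  by rewrite linear0 scaler0 subr0.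
have -> : i - 1 + n = i + m by rewrite En [m + 1]addrC addrA subrK.
have f0 k l : f k l 0 = 0.
  have := @hom_linear _ f k l (-1) 0 0.
  by rewrite scaleN1r oppr0 addr0 scaleN1r addNr.
rewrite linearB linearZ_LR !diffK f0 scaler0 subr0 sub0r.
have -> : (-1) ^+ absz n = - (-1) ^+ absz m :> R by rewrite En sign_succz.
by rewrite scaleNr opprK subrr.
Qed.

Definition hom_complex : complex int := Complex hom_diff_shape hom_diffK.

End HomComplex.

Section DerivedFunctors.
Variable A : pzRingType.

Definition is_proj_resolution (P M : complex A) : Prop :=
  [/\ exists b : int, forall v, v < b -> is_zero (P v),
      forall v, projective (P v)
    & exists f : chain_map P M, quasi_iso f].

(* A chosen projective resolution; the value is only meaningful when M is
   homologically right-bounded, which is when such a resolution exists. *)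
Definition proj_resolution (M : complex A) : complex A :=
  if pselect (exists P, is_proj_resolution P M) is left MP
  then sval (cid MP) else M.

Definition RHom (M N : complex A) : complex int :=
  hom_complex (proj_resolution M) N.

Definition Ext (i : nat) (M N : lmodType A) : lmodType int :=
  homology (RHom (stalk M) (stalk N)) (- i%:Z).

Definition condition_AC : Prop :=
  forall M : lmodType A, fin_gen M ->
  exists b : nat, forall N : lmodType A, fin_gen N ->
    (exists m : nat, forall i, (m < i)%N -> is_zero (Ext i M N)) ->
    forall i, (b < i)%N -> is_zero (Ext i M N).

(* Infimum and supremum in the integers extended by -oo and +oo. *)
Definition pd (M : complex A) : \bar int :=
  infimum +oo%E [set s | exists2 P, is_proj_resolution P M &
    s = supremum -oo%E (EFin @` [set i : int | ~ is_zero (P i)])]%classic.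

End DerivedFunctors.

Definition homologically_bounded (R : pzRingType) (X : complex R) : Prop :=
  exists b : int, forall v, b < `|v| -> is_zero (homology X v).

Definition inf_homology (R : pzRingType) (X : complex R) : \bar int :=
  infimum +oo%E (EFin @` [set v : int | ~ is_zero (homology X v)])%classic.

(* Main.v *)
Require Import Defs.
From HB Require Import structures.
From mathcomp Require Import all_boot all_order all_algebra.
From mathcomp Require Import mathcomp_extra boolp classical_sets functions.
From mathcomp Require Import constructive_ereal.
From mathcomp Require Import zify.

Set Implicit Arguments.
Unset Strict Implicit.
Unset Printing Implicit Defensive.

Import Order.TTheory GRing.Theory Num.Theory.
Local Open Scope ring_scope.

(* Let P be a resolution of M by finitely generated projectives and let Z_u be
   the cycles of P in a degree u beyond which P is exact.  Since RHom(M, A) is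
   bounded, Hom(P, -) of a finitely generated projective module is exact in all
   large cohomological degrees, so a cocycle P_j -> Z_u with j large extends to
   a chain endomorphism of P of degree u + 1 - j; this is null-homotopic because
   RHom(M, M) is bounded, so the cocycle is a coboundary.  Dimension shifting
   gives the same for every higher syzygy Z_(u + m), and then (AC) for Z_u yields
   a bound on the degrees that is uniform in m.  Taking m equal to that bound,
   the differential P_(k + 1) -> Z_k is a coboundary, which splits Z_k off P_k and
   truncates P to a finite resolution.  As long as the top cohomology of
   Hom(P, A) vanishes, the top term of the truncation splits off again, so the
   length can be brought down to the largest i for which the cohomology of
   Hom(P, A) in degree i is nonzero; no projective resolution can be shorter. *)

(** * Linear maps and modules *)

Section LinearMaps.
Variable A : pzRingType.

Definition lin_of (U V : lmodType A) (f : U -> V) (fL : linear f) :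
  {linear U -> V} := HB.pack f (GRing.isLinear.Build A U V *:%R f fL).

Lemma sign_scale_linear (U V : lmodType A) n (f : {linear U -> V}) :
  linear (fun x => (-1) ^+ n *: f x).
Proof.
move=> a x y; rewrite linearP scalerDr !scalerA; congr (_ *: _ + _).
by rewrite -signr_odd; case: odd; rewrite ?mul1r ?mulr1 ?mulN1r ?mulrN1.
Qed.

Definition sign_scale (U V : lmodType A) n (f : {linear U -> V}) :=
  lin_of (sign_scale_linear n f).

Section Kernel.
Variables (U V : lmodType A) (f : {linear U -> V}).

Definition ker_pred : {pred U} := fun x => f x == 0.

Fact ker_pred_submod : subsemimod_closed ker_pred.
Proof.
split; first split.
- by rewrite unfold_in linear0.
- by move=> x y; rewrite !unfold_in linearD => /eqP-> /eqP->; rewrite addr0.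
- by move=> a x; rewrite !unfold_in linearZ_LR => /eqP->; rewrite scaler0.
Qed.
HB.instance Definition _ :=
  GRing.isSubmodClosed.Build A U ker_pred ker_pred_submod.

Record ker := Ker { ker_val : U; _ : ker_val \in ker_pred }.
HB.instance Definition _ := [isSub for ker_val].
HB.instance Definition _ := [Choice of ker by <:].
HB.instance Definition _ := [SubChoice_isSubLmodule of ker by <:].

Fact ker_val_linear : linear ker_val.
Proof. by []. Qed.

Definition ker_incl : {linear ker -> U} := lin_of ker_val_linear.

Lemma ker_inclP (x : ker) : f (ker_incl x) = 0.
Proof. by case: x => x /= /eqP. Qed.

Lemma ker_incl_inj : injective ker_incl.
Proof. exact: val_inj. Qed.

Lemma ker_lift (W : lmodType A) (h : {linear W -> U}) :
  (forall w, f (h w) = 0) ->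
  exists k : {linear W -> ker}, forall w, ker_incl (k w) = h w.
Proof.
move=> fh.
have hk w : h w \in ker_pred by rewrite unfold_in fh.
have kL : linear (fun w => Ker (hk w)).
  by move=> a x y; apply: val_inj => /=; rewrite linearP.
by exists (lin_of kL).
Qed.

End Kernel.

(** The fibre product of [h] and [g] surjects onto [P], so the identity of [P] lifts to it; [g] only
    has to reach the image of [h]. *)
Lemma projective_lift (P V W : lmodType A) (g : {linear V -> W})
    (h : {linear P -> W}) :
  projective P -> (forall x, exists v, g v = h x) ->
  exists k : {linear P -> V}, forall x, g (k x) = h x.
Proof.
move=> Pproj gh.
pose d : {linear (P * V)%type -> W} := (h \o fst) \- (g \o snd).
have [|k kE] := Pproj _ _ (fst \o ker_incl d) idfun.
  move=> x; have [v gv] := gh x.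
  have xv : (x, v) \in ker_pred d by rewrite unfold_in /= gv subrr.
  by exists (Ker xv).
exists (snd \o ker_incl d \o k) => x /=.
have /= /eqP := ker_inclP (k x); rewrite subr_eq0 => /eqP <-.
by have /= -> := kE x.
Qed.

Definition linear_combination n (V : lmodType A) (g : 'I_n -> V)
    (x : 'rV[A]_n) : V := \sum_k x 0 k *: g k.

Fact linear_combination_linear n (V : lmodType A) (g : 'I_n -> V) :
  linear (linear_combination g).
Proof.
move=> a x y; rewrite /linear_combination scaler_sumr -big_split /=.
by apply: eq_bigr => k _; rewrite !mxE scalerDl scalerA.
Qed.

Definition lincomb n (V : lmodType A) (g : 'I_n -> V) :=
  lin_of (linear_combination_linear g).

Lemma lincombE n (V : lmodType A) (g : 'I_n -> V) c :
  \sum_k c k *: g k = lincomb g (\row_k c k).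
Proof. by apply: eq_bigr => k _; rewrite mxE. Qed.

Lemma linear_lincomb n (V W : lmodType A) (f : {linear V -> W}) (g : 'I_n -> V) x :
  f (lincomb g x) = lincomb (f \o g) x.
Proof.
by rewrite /= /linear_combination linear_sum; apply: eq_bigr => k _; rewrite linearZ_LR.
Qed.

Lemma eq_lincomb n (V : lmodType A) (g g' : 'I_n -> V) x :
  g =1 g' -> lincomb g x = lincomb g' x.
Proof. by move=> gg; apply: eq_bigr => k _; rewrite gg. Qed.

Lemma projective_rV n : projective 'rV[A]_n.
Proof.
move=> U V g h gsurj.
have [u uE] := choice (fun k : 'I_n => gsurj (h (delta_mx 0 k))).
exists (lincomb u) => x; rewrite linear_lincomb (eq_lincomb _ uE).
rewrite [in RHS](row_sum_delta x) linear_sum.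
by apply: eq_bigr => k _; rewrite linearZ_LR.
Qed.

Lemma projective_retract (P Q : lmodType A) (i : {linear P -> Q})
    (p : {linear Q -> P}) :
  cancel i p -> projective Q -> projective P.
Proof.
move=> ip Qproj U V g h gsurj.
have [k kE] := Qproj _ _ g (h \o p) gsurj.
by exists (k \o i) => x; rewrite /= kE /= ip.
Qed.

Lemma fin_genP (V : lmodType A) : fin_gen V <->
  exists n (g : 'I_n -> V), forall x, exists c, lincomb g c = x.
Proof.
split=> -[n [g gP]]; exists n, g => x; have [c] := gP x.
  by move=> ->; rewrite lincombE; eexists.
by move=> <-; exists (fun k => c 0 k).
Qed.

Lemma fin_gen_surj (U V : lmodType A) (f : {linear U -> V}) :
  (forall y, exists x, f x = y) -> fin_gen U -> fin_gen V.
Proof.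
move=> fs /fin_genP[n [g gP]]; apply/fin_genP; exists n, (f \o g) => y.
have [x <-] := fs y; have [c <-] := gP x; exists c.
by rewrite linear_lincomb.
Qed.

Lemma fin_gen_rV n : fin_gen 'rV[A]_n.
Proof.
by exists n, (fun k => delta_mx 0 k) => x; exists (fun k => x 0 k); exact: row_sum_delta.
Qed.

Lemma fin_gen_proj_retract (P : lmodType A) : fin_gen P -> projective P ->
  exists n (i : {linear P -> 'rV[A]_n}) (p : {linear 'rV[A]_n -> P}), cancel i p.
Proof.
move=> /fin_genP[n [g gP]] Pproj.
have [k kE] := Pproj _ _ (lincomb g) idfun gP.
by exists n, k, (lincomb g).
Qed.

End LinearMaps.

(** * Recursive constructions indexed by the integers *)

(* The neighbour relation is spelled j = i + 1 with both indices free, so that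
   no value is ever transported along an equality of indices. *)
Lemma int_rec_ge (F : int -> Type) (G : forall i, F i -> Prop)
    (Q : forall i j, F i -> F j -> Prop) (b : int) (x0 : F b) :
  G b x0 -> (forall i, F i) ->
  (forall i j, j = i + 1 -> b <= i -> forall x : F i, G i x ->
    exists2 y : F j, G j y & Q i j x y) ->
  exists2 s : forall i, F i, s b = x0 &
    forall i j, j = i + 1 -> b <= i -> Q i j (s i) (s j).
Proof.
move=> Gx0 dflt step.
have step' k (x : {x : F (b + k%:Z) | G _ x}) :
    {y : {y : F (b + k.+1%:Z) | G _ y} | Q _ _ (sval x) (sval y)}.
  case: x => x Gx; apply: cid.
  have [||y Gy Qy] := step (b + k%:Z) (b + k.+1%:Z) _ _ x Gx; try lia.
  by exists (exist _ y Gy).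
have [y0 Gy0 y0E] : exists2 y, G (b + 0) y & Tagged F y = Tagged F x0.
  by move: (b + 0) (addr0 b) => c e; subst c; exists x0.
pose s := fix s (k : nat) : {x : F (b + k%:Z) | G _ x} :=
  if k is k'.+1 then sval (step' k' (s k')) else exist _ y0 Gy0.
have [t tE] : {t : forall i, F i | forall k, t (b + k%:Z) = sval (s k)}.
  (* Quantifying over every proof [e] makes the transported value independent of the proof; below
     [b] the default is taken. *)
  have ex i : {x : F i | forall k (e : b + k%:Z = i), eq_rect _ F (sval (s k)) _ e = x}.
    apply: cid; have [bi|ib] := leP b i; last by exists (dflt i) => k; lia.
    have e : b + `|i - b|%N%:Z = i by lia.
    exists (eq_rect _ F (sval (s `|i - b|%N)) _ e) => k e'.
    have kE : k = `|i - b|%N by lia.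
    by subst k; rewrite (Prop_irrelevance e e').
  exists (fun i => sval (ex i)) => k.
  exact/esym/(svalP (ex (b + k%:Z)) k erefl).
exists t => [|i j ji bi].
  apply: (@eq_from_Tagged int F); rewrite -y0E -[y0]/(sval (s 0%N)) -tE.
  by have -> : b + 0%N%:Z = b by exact: addr0.
have iE : i = b + `|i - b|%N%:Z by lia.
have jE : j = b + `|i - b|.+1%N%:Z by lia.
move: (absz _) iE jE => k iE jE; subst i j.
by rewrite jE !tE; apply: (svalP (step' k (s k))).
Qed.

(** The downward half is the upward recursion for the reflected family [F (- i)] with the relation
    reversed; both halves take the value [x0] at [b]. *)
Lemma int_rec (F : int -> Type) (G : forall i, F i -> Prop)
    (Q : forall i j, F i -> F j -> Prop) (b : int) (x0 : F b) :
  G b x0 -> (forall i, F i) ->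
  (forall i j, j = i + 1 -> b <= i -> forall x : F i, G i x ->
    exists2 y : F j, G j y & Q i j x y) ->
  (forall i j, j = i + 1 -> j <= b -> forall y : F j, G j y ->
    exists2 x : F i, G i x & Q i j x y) ->
  exists2 s : forall i, F i, s b = x0 & forall i j, j = i + 1 -> Q i j (s i) (s j).
Proof.
move=> Gx0 dflt up down.
have [s s0 sQ] := int_rec_ge Gx0 dflt up.
have [x0' Gx0' x0'E] : exists2 x, G (- - b) x & Tagged F x = Tagged F x0.
  by move: (- - b) (opprK b) => c e; subst c; exists x0.
have [|t t0 tQ] := @int_rec_ge (fun i => F (- i)) (fun i => @G (- i))
  (fun i j x y => Q _ _ y x) (- b) x0' Gx0' (fun i => dflt (- i)).
  by move=> i j ji bi x Gx; apply: down => //; lia.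
have [u uE] : {u : forall i, F i | forall i, u (- i) = t i}.
  exists (fun i => eq_rect _ F (t (- i)) _ (opprK i)) => i.
  have gen j (e : - j = - i) : j = i -> eq_rect _ F (t j) _ e = t i.
    by move=> ji; subst j; rewrite (Prop_irrelevance e erefl).
  exact: gen (opprK i).
have ub : u b = x0.
  by apply: (@eq_from_Tagged int F); rewrite -x0'E -t0 -uE opprK.
exists (fun i => if b <= i then s i else u i) => [|i j ji].
  by rewrite lexx.
have [bi|ib] := leP b i.
  by rewrite ifT; [exact: sQ | lia].
have uQ : Q i j (u i) (u j).
  have := tQ (- j) (- i) ltac:(lia) ltac:(lia).
  by rewrite -!uE !opprK.
case: ifP => // bj.
have jb : j = b by lia.
by subst b; rewrite s0 -ub.
Qed.

(** * Homology and Hom complexes *)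

Section HomologyFacts.
Variables (R : pzRingType) (X : complex R).

(** The adjacent degrees are variables tied by equations, which spares casts between types over
    [v - 1 + 1] and over [v]. *)
Definition exact_at v := forall u w (z : X v), v = u + 1 -> w = v + 1 ->
  diff X v u z = 0 -> exists y, diff X w v y = z.

Lemma cyclesP v (z : cycles X v) u : v = u + 1 -> diff X v u (cycle_val z) = 0.
Proof.
move=> vu; have -> : u = v - 1 by rewrite vu addrK.
by case: z => z /= /eqP.
Qed.

Lemma mk_cycles v u (z : X v) : v = u + 1 -> diff X v u z = 0 ->
  exists z' : cycles X v, cycle_val z' = z.
Proof.
move=> vu dz; have zc : z \in @cycle_pred R X v.
  apply/eqP; have uE : u = v - 1 by rewrite vu addrK.
  by rewrite -uE.
by exists (Cycles zc).
Qed.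

Lemma homology_classP v (z z' : cycles X v) w : w = v + 1 ->
  homology_class z = homology_class z' <->
  exists y, cycle_val z = cycle_val z' + diff X w v y.
Proof.
move=> ->; split.
  move=> /eqP; rewrite -Quotient.idealrBE => /asboolP[y yE].
  by exists y; rewrite yE [RHS]addrC subrK.
move=> [y yE]; apply/eqP; rewrite -Quotient.idealrBE; apply/asboolP.
by exists y; rewrite /= yE addrAC subrr add0r.
Qed.

Lemma homology_class_surj v (h : homology X v) :
  exists z : cycles X v, homology_class z = h.
Proof. by exists (repr h); exact: homology_classK. Qed.

Lemma homology_class0 v : homology_class (0 : cycles X v) = 0.
Proof.
by apply: (addIr (homology_class 0)); rewrite -homology_classD !add0r.
Qed.

Lemma homology_eq0 v : is_zero (homology X v) <-> exact_at v.
Proof.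
split=> [H u w z vu wv dz|H h].
  have [z' zE] := mk_cycles vu dz.
  have /(homology_classP _ _ wv)[y] : homology_class z' = homology_class 0.
    exact: etrans (H _) (esym (H _)).
  by rewrite zE add0r => ->; exists y.
have [z <-] := homology_class_surj h; rewrite -homology_class0.
apply/(homology_classP _ _ erefl).
have [||y yE] := H (v - 1) (v + 1) (cycle_val z) _ erefl.
- by rewrite subrK.
- by apply: cyclesP; rewrite subrK.
by exists y; rewrite yE add0r.
Qed.

Lemma exact_atW v : (forall z : X v, diff X v (v - 1) z = 0 ->
    exists y, diff X (v + 1) v y = z) -> exact_at v.
Proof.
move=> H u w z vu ->; have -> : u = v - 1 by rewrite vu addrK.
exact: H.
Qed.

End HomologyFacts.

Section QuasiIso.
Variables (R : pzRingType) (X Y : complex R) (f : chain_map X Y).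

Lemma homology_mapE v (z : cycles X v) :
  homology_map f (homology_class z) = homology_class (Defs.cycle_map f z).
Proof.
rewrite /homology_map; apply/(homology_classP _ _ erefl).
have /(homology_classP _ _ erefl)[y yE] := homology_classK (homology_class z).
by exists (f (v + 1) y); rewrite /= yE linearD chain_funC.
Qed.

Definition homology_inj := forall v u w w' (x : X v) (y : Y w),
  v = u + 1 -> w = v + 1 -> w' = w -> diff X v u x = 0 -> f v x = diff Y w v y ->
  exists x', x = diff X w' v x'.

Definition homology_surj := forall v u w (y : Y v),
  v = u + 1 -> w = v + 1 -> diff Y v u y = 0 ->
  exists (x : X v) y', diff X v u x = 0 /\ y = f v x + diff Y w v y'.

Lemma quasi_isoP : quasi_iso f <-> homology_inj /\ homology_surj.
Proof.
split=> [fq|[finj fsurj] v].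
  split=> [v u w w' x y vu wv -> dx fx|v u w y vu wv dy].
    have [z zE] := mk_cycles vu dx.
    have [] := (homology_classP z 0 wv).1.
      apply: (bij_inj (fq v)); rewrite !homology_mapE.
      apply/(homology_classP _ _ wv); exists y.
      by rewrite /= zE fx linear0 add0r.
    by move=> x'; rewrite zE add0r => ->; exists x'.
  have [z zE] := mk_cycles vu dy.
  have [g _ gK] := fq v.
  have [x xE] := homology_class_surj (g (homology_class z)).
  have := gK (homology_class z).
  rewrite -xE homology_mapE => /esym/(homology_classP _ _ wv)[y'].
  rewrite zE => ->; exists (cycle_val x), y'; split=> //.
  exact: cyclesP.
have minj : injective (@homology_map _ _ _ f v).
  move=> h h'; have [x <-] := homology_class_surj h.
  have [x' <-] := homology_class_surj h'.
  rewrite !homology_mapE => /(homology_classP _ _ erefl)[y yE].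
  have [|||x0 xE] := finj v (v - 1) _ (v + 1) (cycle_val x - cycle_val x') y _ erefl erefl.
  - by rewrite subrK.
  - by rewrite linearB !cyclesP ?subrK ?subr0.
  - by move: yE; rewrite /= linearB => ->; rewrite addrAC subrr add0r.
  by apply/(homology_classP _ _ erefl); exists x0; rewrite -xE [RHS]addrC subrK.
have msurj h : exists h', @homology_map _ _ _ f v h' = h.
  have [z <-] := homology_class_surj h.
  have [||x [y [dx yE]]] := fsurj v (v - 1) _ (cycle_val z) _ erefl.
  - by rewrite subrK.
  - by rewrite cyclesP ?subrK.
  have [|x' x'E] := mk_cycles _ dx; first by rewrite subrK.
  exists (homology_class x'); rewrite homology_mapE.
  apply/esym/(homology_classP _ _ erefl); exists y.
  by rewrite yE /= x'E.
have [g gK] := choice msurj.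
by exists g => h //; apply: minj; rewrite gK.
Qed.

End QuasiIso.

(* Families of maps are indexed by all pairs of degrees, but only the
   components i -> i + v of a family of degree v are ever constrained. *)
Section Families.
Variable R : pzRingType.

Definition family (X Y : complex R) := forall i j, {linear X i -> Y j}.

Section TwoComplexes.
Variables (X Y : complex R) (v : int).

Definition chain_family (f : family X Y) := forall i j i' j' x,
  i = i' + 1 -> j = j' + 1 -> j = i + v ->
  diff Y j j' (f i j x) = f i' j' (diff X i i' x).

Definition null_homotopy (f s : family X Y) := forall i j i' j' x,
  i = i' + 1 -> j' = j + 1 -> j = i + v ->
  f i j x = diff Y j' j (s i j' x) + s i' j (diff X i i' x).

Definition null_at :=
  forall f, chain_family f -> exists s, null_homotopy f s.

End TwoComplexes.

Definition family_sign X Y (v : int) (f : family X Y) : family X Y :=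
  fun i j => sign_scale (`|v| * `|i|) (f i j).

Lemma family_signP (v i i' : int) : i = i' + 1 ->
  (-1) ^+ (`|v| * `|i|) = (-1) ^+ (`|v| * `|i'|) * (-1) ^+ `|v| :> R.
Proof.
move=> ->; rewrite -exprD addnC exprD ![(`|v| * _)%N]mulnC !exprM sign_succz -mulN1r.
by rewrite exprMn_comm //; exact: commr_sign.
Qed.

Lemma signK n : (-1) ^+ n * (-1) ^+ n = 1 :> R.
Proof. by rewrite -exprD addnn -muln2 exprM sqrr_sign. Qed.

(* The twist by (-1)^(v i) turns the Koszul signs of the Hom complex into the
   sign-free conventions of chain_family and null_homotopy. *)
Lemma exact_hom_complex X Y v :
  exact_at (hom_complex X Y) v <-> null_at X Y v.
Proof.
(* A [hom] has to vanish off its diagonal while a family is arbitrary there, so only the diagonal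
   components are retained. *)
have diag n (f : family X Y) : exists g : Defs.hom X Y n,
    forall i x, g i (i + n) x = f i (i + n) x.
  pose g i j x : Y j := if j == i + n then f i j x else 0.
  have gL i j : linear (g i j).
    move=> a x y; rewrite /g; case: eqP => _; first exact: linearP.
    by rewrite scaler0 addr0.
  have gD i j : j != i + n -> forall x, g i j x = 0.
    by move=> /negPf ji x; rewrite /g ji.
  by exists (Defs.Hom gL gD) => i x; rewrite /= /g eqxx.
split=> [H f fC|H].
  have [g gE] := diag v (family_sign v f).
  have [||h hE] := H (v - 1) (v + 1) g _ erefl; first by rewrite subrK.
    apply: homP => i j x; rewrite /= /hom_diff_val subrK eqxx.
    have [->|ji] := eqVneq j (i + (v - 1)); last first.
      rewrite diff_shape; last by lia.
      by rewrite [g (i - 1) j _]hom_degree ?scaler0 ?subr0 //; lia.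
    rewrite gE.
    have -> : i + (v - 1) = i - 1 + v by lia.
    rewrite gE /= linearZ_LR scalerA.
    rewrite (@family_signP v i (i - 1)) ?subrK // -exprD addnC exprD.
    rewrite (fC i _ (i - 1) (i - 1 + v)) ?subrK //; last by lia.
    by rewrite subrr.
  pose s i j : {linear X i -> Y j} := sign_scale (`|v| * `|i|) (lin_of (@hom_linear _ _ _ _ h i j)).
  exists s => i j i' j' x ii' jj' ji.
  have : g i j x = (hom_diff_fun v h) i j x by rewrite -hE.
  rewrite ji gE /= /hom_diff_val eqxx.
  move=> /(congr1 (fun y => (-1) ^+ (`|v| * `|i|) *: y)).
  rewrite scalerA signK scale1r => ->.
  rewrite scalerBr /s /=.
  have jE : i + (v + 1) = j' by lia.
  have iE : i - 1 = i' by lia.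
  rewrite jE iE; congr (_ + _); first by rewrite linearZ_LR.
  rewrite sign_succz scaleNr scalerN opprK scalerA.
  by rewrite (family_signP v ii') -mulrA signK mulr1.
apply: exact_atW => z dz.
pose f : family X Y := fun i j => sign_scale (`|v| * `|i|) (lin_of (@hom_linear _ _ _ _ z i j)).
have [|s sE] := H f.
  move=> i j i' j' x ii' jj' ji.
  have : (hom_diff_fun (v - 1) z) i j' x = 0 by rewrite [hom_diff_fun _ _]dz.
  rewrite /= /hom_diff_val subrK eqxx => /eqP; rewrite subr_eq0.
  have iE : i - 1 = i' by lia.
  rewrite -ji iE => /eqP zE.
  rewrite linearZ_LR zE scalerA; congr (_ *: _).
  by rewrite (family_signP v ii') -mulrA signK mulr1.
have [g gE] := diag (v + 1) (family_sign v s).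
exists g; apply: homP => i j x; rewrite /= /hom_diff_val eqxx.
have [ji|ji] := eqVneq j (i + v); last first.
  rewrite [RHS]hom_degree // diff_shape; last by lia.
  by rewrite [g (i - 1) j _]hom_degree ?scaler0 ?subr0 //; lia.
have := sE i j (i - 1) (i + (v + 1)) x ltac:(lia) ltac:(lia) ji.
move=> /(congr1 (fun y => (-1) ^+ (`|v| * `|i|) *: y)).
rewrite /= scalerA signK scale1r => ->.
rewrite gE /= scalerDr; congr (_ + _); first by rewrite linearZ_LR.
have jE : i - 1 + (v + 1) = j by lia.
rewrite -jE gE /= jE.
rewrite sign_succz scaleNr opprK scalerA.
by rewrite (@family_signP v i (i - 1)) ?subrK // -!exprD addnC.
Qed.

End Families.

(** * Lifting along quasi-isomorphisms *)

Section Lifting.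
Variable R : pzRingType.

Lemma sub_swap (V : zmodType) (a b c : V) : a - b = c -> a = c + b.
Proof. by move=> <-; rewrite subrK. Qed.

Definition zero_family (X Y : complex R) : family X Y := fun i j => \0.

Lemma pair_linear (U V W : lmodType R) (f : {linear U -> V}) (g : {linear U -> W}) :
  linear (fun x => (f x, g x)).
Proof. by move=> a x y; congr (_, _); exact: linearP. Qed.

Definition pair_map (U V W : lmodType R) (f : {linear U -> V}) (g : {linear U -> W}) :
  {linear U -> (V * W)%type} := lin_of (pair_linear f g).

Section QuasiIsoLift.
Variables (P X Y : complex R) (q : chain_map X Y) (v : int).

(* Vanishing of the mapping cone of q, read off on elements. *)
Lemma cone_exact u k k1 k2 (a : X k) (b : Y k1) : quasi_iso q ->
  k = u + 1 -> k1 = k + 1 -> k2 = k1 + 1 ->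
  diff X k u a = 0 -> q k a = diff Y k1 k b ->
  exists (x : X k1) (y : Y k2), diff X k1 k x = a /\ q k1 x + diff Y k2 k1 y = b.
Proof.
move=> /quasi_isoP[qinj qsurj] ku k1k k2k1 da qa.
have [x0 aE] := qinj _ _ _ _ _ _ ku k1k erefl da qa.
have [|x1 [y [dx1 bE]]] := qsurj k1 k k2 (b - q k1 x0) k1k k2k1.
  by rewrite linearB -chain_funC -aE -qa subrr.
exists (x0 + x1), y; rewrite linearD dx1 addr0 -aE; split=> //.
by rewrite linearD -addrA -bE addrC subrK.
Qed.

(** A null homotopy [t] of [q f] lifts to one of [f] because the cone of [q] is exact and [P] is
    projective and bounded below. The correction [u] between [t] and [q s] is built in the same
    recursion: the pair ([s], [u]) lifts into the cone. *)
Lemma lift_homotopy (f : family P X) (t : family P Y) :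
  (exists b, forall i, i < b -> is_zero (P i)) -> (forall i, projective (P i)) ->
  quasi_iso q -> chain_family v f ->
  (forall i j i' j' x, i = i' + 1 -> j' = j + 1 -> j = i + v ->
    q j (f i j x) = diff Y j' j (t i j' x) + t i' j (diff P i i' x)) ->
  exists (s : family P X) (u : family P Y),
    null_homotopy v f s /\
    forall i j i' j' x, i = i' + 1 -> j' = j + 1 -> j = i + v + 1 ->
      t i j x = q j (s i j x) + diff Y j' j (u i j' x) - u i' j (diff P i i' x).
Proof.
move=> [b P0] Pproj qq fC tE.
(* A stage consists of the components of [s] and [u] out of [P i]. [G] says that the obstruction in
   the next degree is a cycle of the cone, [Q] that the next stage bounds it. *)
pose F i : Type := ((forall k, {linear P i -> X k}) * (forall k, {linear P i -> Y k}))%type.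
pose G i (z : F i) := forall i1 k k' k1 (p : P i1),
  i1 = i + 1 -> k = i1 + v -> k = k' + 1 -> k1 = k + 1 ->
  diff X k k' (f i1 k p - z.1 k (diff P i1 i p)) = 0 /\
  q k (f i1 k p - z.1 k (diff P i1 i p)) =
    diff Y k1 k (t i1 k1 p + z.2 k1 (diff P i1 i p)).
pose Q i j (z : F i) (z' : F j) := forall k k1 k2 (p : P j),
  k = j + v -> k1 = k + 1 -> k2 = k1 + 1 ->
  f j k p - z.1 k (diff P j i p) = diff X k1 k (z'.1 k1 p) /\
  t j k1 p + z.2 k1 (diff P j i p) = q k1 (z'.1 k1 p) + diff Y k2 k1 (z'.2 k2 p).
pose z0 i : F i := (zero_family P X i, zero_family P Y i).
have G0 i (z : F i) : i + 1 < b -> G i z.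
  move=> ib i1 k k' k1 p i1E _ _ _; have := P0 i1 ltac:(lia) p => ->.
  by rewrite !(linear0, subr0, addr0).
have [||i j jE ib z Gz|i j jE jb z Gz|s _ sQ] := @int_rec F G Q (b - 2) (z0 _).
- by apply: G0; lia.
- exact: z0.
- pose k := j + v.
  pose h := pair_map (f j k \- (z.1 k \o diff P j i))
    (t j (k + 1) \+ (z.2 (k + 1) \o diff P j i)).
  pose g := pair_map
    (diff X (k + 1) k \o fst : {linear (X (k + 1)%R * Y (k + 1 + 1)%R)%type -> _})
    ((q (k + 1) \o fst) \+ (diff Y (k + 1 + 1) (k + 1) \o snd)).
  have [|y yE] := projective_lift (g := g) (h := h) (Pproj j).
    move=> p; have [|da qa] := Gz j k (k - 1) (k + 1) p jE erefl _ erefl.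
      by rewrite subrK.
    have [|x [y [xE yE]]] := cone_exact qq _ erefl erefl da qa.
      by rewrite subrK.
    by exists (x, y); congr (_, _).
  pose z' : F j := (dfwith (zero_family P X j) (k + 1) (fst \o y),
                    dfwith (zero_family P Y j) (k + 1 + 1) (snd \o y)).
  have Qz : Q i j z z'.
    move=> k0 k1 k2 p kE k1E k2E; subst k2 k1 k0.
    by rewrite /z' /= !dfwithin /=; have [-> ->] := yE p.
  exists z' => //; clearbody z' => i1 k2 k' k3 p i1E k2E k2k' k3E.
  have [xE uE] := Qz k' k2 k3 (diff P i1 j p) ltac:(lia) ltac:(lia) k3E.
  rewrite diffK !(linear0, subr0, addr0) in xE uE.
  have fE : diff X k2 k' (f i1 k2 p) = diff X k2 k' (z'.1 k2 (diff P i1 j p)).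
    by rewrite -xE (fC i1 k2 j k').
  rewrite linearB fE subrr; split=> //.
  rewrite linearB (tE i1 k2 j k3) // uE linearD.
  by rewrite [q k2 _ + _]addrC addrA addrK.
- exists (z0 i); first by apply: G0; lia.
  move=> k k1 k2 p _ _ _; have := P0 j ltac:(lia) p => ->.
  by rewrite !(linear0, subr0, addr0).
exists (fun i => (s i).1), (fun i => (s i).2); split.
  move=> i j i' j' x iE j'E jE.
  have [+ _] := sQ i' i iE j j' (j' + 1) x jE j'E erefl.
  exact: sub_swap.
move=> i j i' j' x iE j'E jE.
have [_ <-] := sQ i' i iE (i + v) j j' x erefl jE j'E.
by rewrite addrK.
Qed.

End QuasiIsoLift.

Lemma null_at_quasi_iso (P X Y : complex R) (q : chain_map X Y) v :
  (exists b, forall i, i < b -> is_zero (P i)) -> (forall i, projective (P i)) ->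
  quasi_iso q -> null_at P Y v -> null_at P X v.
Proof.
move=> Pb Pproj qq PY f fC.
have [|t tE] := PY (fun i j => q j \o f i j).
  move=> i j i' j' x iE jE ji.
  by rewrite /= -chain_funC (fC i j i' j').
have [|s [_ [sE _]]] := lift_homotopy Pb Pproj qq fC (t := t); last by exists s.
by move=> i j i' j' x iE jE ji; rewrite -(tE i j i' j').
Qed.

Lemma sign_pred (i i' : int) : i = i' + 1 -> (-1) ^+ `|i| = - (-1) ^+ `|i'| :> R.
Proof. by move=> ->; exact: sign_succz. Qed.

(** With alternating signs, [g] is a null homotopy of the zero map of degree [v - 1]. Lifting this
    homotopy and undoing the signs gives the chain map [f], and the correction term becomes the
    homotopy between [q f] and [g]. *)
Lemma lift_chain_family (P X Y : complex R) (q : chain_map X Y) v (g : family P Y) :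
  (exists b, forall i, i < b -> is_zero (P i)) -> (forall i, projective (P i)) ->
  quasi_iso q -> chain_family v g ->
  exists2 f : family P X, chain_family v f &
    exists s, null_homotopy v (fun i j => (q j \o f i j) \- g i j) s.
Proof.
move=> Pb Pproj qq gC.
have [||s [u [sE uE]]] := @lift_homotopy P X Y q (v - 1) (zero_family P X)
  (fun i j => sign_scale `|i| (g i j)) Pb Pproj qq.
- by move=> i j i' j' x iE jE ji; rewrite /= linear0.
- move=> i j i' j' x iE jE ji; rewrite /= !linearZ_LR (sign_pred iE) linear0.
  by rewrite scaleNr (gC i j' i' j) ?addNr //; lia.
exists (fun i j => sign_scale `|i| (s i j)).
  move=> i j i' j' x iE jE ji; rewrite /= linearZ_LR.
  have /eqP := sE i j' i' j x iE jE ltac:(lia).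
  rewrite /= eq_sym addr_eq0 => /eqP ->.
  by rewrite (sign_pred iE) scaleNr scalerN opprK.
exists (fun i j => sign_scale `|i|.+1 (u i j)) => i j i' j' x iE jE ji.
have gE := uE i j i' j' x iE jE ltac:(lia).
rewrite /= !linearZ_LR -[g i j x](signrZK `|i|) [_ *: g i j x]gE -scalerBr.
rewrite !exprS !mulN1r -(sign_pred iE) scaleNr -scalerN -scalerDr; congr (_ *: _).
by rewrite opprB addrCA opprD [q j _ + _]addrA subrr add0r addrC.
Qed.

(** Comparison maps [phi : P -> P'] and [psi : P' -> P] over [M] have [psi phi] homotopic to the
    identity, so a chain family [f] on [P] is null as soon as [f psi] is. *)
Lemma null_at_resolution (M P P' N : complex R) v :
  is_proj_resolution P M -> is_proj_resolution P' M ->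
  null_at P' N v -> null_at P N v.
Proof.
move=> [Pb Pproj [q qq]] [Pb' Pproj' [q' qq']] nullP' f fC.
have chainq (X : complex R) (p : chain_map X M) (e : family X M) :
    (forall i, e i i = p i) -> chain_family 0 e.
  move=> eE i j i' j' x iE jE; rewrite addr0 => ji.
  have j'E : j' = i' by lia.
  by rewrite ji j'E !eE chain_funC.
have diag (X : complex R) (p : chain_map X M) :
    exists e : family X M, forall i, e i i = p i.
  by exists (fun i => dfwith (zero_family X M i) i (p i)) => i; rewrite dfwithin.
have [e eE] := diag _ q; have [e' eE'] := diag _ q'.
have [phi phiC [h hE]] := lift_chain_family Pb Pproj qq' (chainq _ _ _ eE).
have [psi psiC [h' hE']] := lift_chain_family Pb' Pproj' qq (chainq _ _ _ eE').
have compC : chain_family 0 (fun i j => psi i j \o phi i i).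
  move=> i j i' j' x iE jE ji.
  by rewrite /= (psiC i j i' j') // (phiC i i i' i') // addr0.
have idC : exists2 e : family P P, chain_family 0 e & forall i x, e i i x = x.
  exists (fun i => dfwith (zero_family P P i) i idfun) => [|i x]; last by rewrite dfwithin.
  move=> i j i' j' x iE jE; rewrite addr0 => ji.
  have j'E : j' = i' by lia.
  by rewrite ji j'E !dfwithin.
have [one oneC oneE] := idC.
(* After [q], the map [psi phi - 1] has the null homotopy [h + h' phi]; hence it has a null homotopy
   [k] itself. *)
have [||k [_ [kE _]]] := @lift_homotopy P P M q 0
  (fun i j => (psi i j \o phi i i) \- one i j)
  (fun i j => h i j \+ (h' i j \o phi i i)) Pb Pproj qq.
- move=> i j i' j' x iE jE ji /=.
  by rewrite linearB (oneC i j i' j') //; have /= -> := compC i j i' j' x iE jE ji.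
- move=> i j i' j' x iE jE; rewrite addr0 => ji; rewrite ji {j ji} /= in jE *.
  have := hE i i i' j' x iE jE ltac:(lia).
  have /= := hE' i i i' j' (phi i i x) iE jE ltac:(lia).
  rewrite eE eE' oneE (phiC i i i' i') ?addr0 // linearB linearD.
  move=> /sub_swap -> /sub_swap ->.
  by rewrite addrA addrK addrACA; congr (_ + _); exact: addrC.
have [|s sE] := nullP' (fun i j => f i j \o psi i i).
  move=> i j i' j' x iE jE ji /=.
  by rewrite (fC i j i' j') // (psiC i i i' i') ?addr0.
(* From [f psi = d s + s d] and [psi phi - 1 = d k + k d] one gets a null homotopy [s phi - f k] of
   [f]. *)
exists (fun i j => (s i j \o phi i i) \- (f (i + 1) j \o k i (i + 1))).
move=> i j i' j' x iE jE ji; subst i => /=.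
have := kE (i' + 1) (i' + 1) i' (i' + 1 + 1) x erefl erefl ltac:(lia).
rewrite /= oneE => /(congr1 (f (i' + 1) j)).
have := sE (i' + 1) j i' j' (phi (i' + 1) (i' + 1) x) erefl jE ji.
rewrite /= linearB linearD linearB => ->.
rewrite (phiC _ _ i' i') ?addr0 //.
rewrite -(fC (i' + 1 + 1) j' (i' + 1) j) //; last by lia.
move=> /eqP; rewrite subr_eq [X in _ == X]addrC -subr_eq => /eqP <-.
by rewrite opprD addrACA.
Qed.

End Lifting.

(** * Free resolutions over noetherian rings *)

Section Noetherian.
Variable A : pzRingType.

Definition submodule_set (V : lmodType A) (S : set V) :=
  S 0 /\ forall a x y, S x -> S y -> S (a *: x + y).

(** Finite generation of the quotient of [S] by [T], without forming the quotient. *)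
Definition fin_gen_modulo (V : lmodType A) (S T : set V) :=
  exists n (g : 'I_n -> V), (forall k, S (g k)) /\
    forall x, S x -> exists c, T (x - lincomb g c).

Lemma submodule_lincomb (V : lmodType A) (S : set V) n (g : 'I_n -> V) c :
  submodule_set S -> (forall k, S (g k)) -> S (lincomb g c).
Proof.
move=> [S0 SP] gS; apply: (big_ind S) => // [x y Sx Sy|k _].
  by rewrite -[x]scale1r; exact: SP.
by rewrite -[_ *: _]addr0; exact: SP.
Qed.

Lemma lincomb_cat (V : lmodType A) m n (g : 'I_m -> V) (h : 'I_n -> V) c d :
  lincomb (fun k : 'I_(m + n) => match fintype.split k with inl i => g i | inr j => h j end)
    (row_mx c d) = lincomb g c + lincomb h d.
Proof.
rewrite /= /linear_combination big_split_ord /=; congr (_ + _).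
  apply: eq_bigr => k _; rewrite row_mxEl.
  by have := unsplitK (inl k : 'I_m + 'I_n); rewrite /= => ->.
apply: eq_bigr => k _; rewrite row_mxEr.
by have := unsplitK (inr k : 'I_m + 'I_n); rewrite /= => ->.
Qed.

Lemma fin_gen_extension (V W : lmodType A) (f : {linear V -> W}) (S T : set V) :
  submodule_set S ->
  fin_gen_modulo (fun w => exists v, S v /\ f v = w) (fun w => w = 0) ->
  fin_gen_modulo (fun v => S v /\ f v = 0) T -> fin_gen_modulo S T.
Proof.
move=> Ssub [m [g [gS gP]]] [n [h [hS hP]]].
have [g' g'P] := choice gS.
exists (m + n)%N, (fun k : 'I_(m + n) => match fintype.split k with inl i => g' i | inr j => h j end).
split=> [k|x Sx]; first by case: fintype.split => i; [case: (g'P i) | case: (hS i)].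
have [|c cE] := gP (f x); first by exists x.
have Sy : S (x - lincomb g' c).
  rewrite addrC -scaleN1r; apply Ssub => //; apply: submodule_lincomb => // k.
  by case: (g'P k).
have [|d dT] := hP (x - lincomb g' c).
  split=> //; rewrite linearB linear_lincomb (@eq_lincomb _ _ _ _ g) => [//|k].
  by case: (g'P k).
by exists (row_mx c d); rewrite lincomb_cat opprD addrA.
Qed.

(** Induction on the rank: the first coordinates of [S] form a left ideal, and the elements with
    first coordinate zero form a submodule of the free module of rank [n]. *)
Lemma left_noetherian_rV n (S : set 'rV[A]_n) : left_noetherian A ->
  submodule_set S -> fin_gen_modulo S (fun x => x = 0).
Proof.
move=> AN; elim: n S => [|n IH] S Ssub.
  exists 0%N, (fun k => 0); split=> [k|x _]; first by case: k.
  by exists 0; exact: thinmx0.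
have fL : linear (fun x : 'rV[A]_(1 + n) => (x 0 0 : A^o)).
  by move=> a x y; rewrite !mxE.
have iL : linear (fun y : 'rV[A]_n => row_mx (0 : 'rV[A]_1) y).
  by move=> a x y; rewrite scale_row_mx add_row_mx scaler0 addr0.
apply: (@fin_gen_extension _ _ (lin_of fL)) => //.
  have [S0 SP] := Ssub.
  have [|r [g gE]] := AN (fun a => exists v, S v /\ lin_of fL v = a).
    split=> [|_ _ [x [Sx <-]] [y [Sy <-]]|a _ [x [Sx <-]]].
    - by exists 0; split=> //; exact: linear0.
    - exists (1 *: x + y); split; first exact: SP.
      by rewrite linearP scale1r.
    - exists (a *: x + 0); split; first exact: SP.
      by rewrite addr0 linearZ_LR.
  have gP a : (exists v, S v /\ lin_of fL v = a) <->
      exists c : 'I_r -> A, a = \sum_(k < r) c k * g k.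
    by have := congr1 (@^~ a) gE => /= ->.
  exists r, g; split=> [k|a /gP[c ->]].
    apply/gP; exists (fun l => (l == k)%:R).
    rewrite (bigD1 k) //= eqxx mul1r big1 ?addr0 // => l /negPf ->.
    by rewrite mul0r.
  exists (\row_k c k); rewrite -(lincombE (g : 'I_r -> A^o)).
  exact: subrr.
have [|r [g [gS gP]]] := IH (fun y => S (lin_of iL y)).
  case: Ssub => S0 SP; split; first by rewrite linear0.
  by move=> a x y Sx Sy; rewrite linearP; exact: SP.
have ord00 : (0 : 'I_(1 + n)) = lshift n 0 by exact: val_inj.
exists r, (lin_of iL \o g); split=> [k|x [Sx x0]].
  by split; [exact: gS | rewrite /= ord00 row_mxEl mxE].
have xE : lin_of iL (rsubmx x) = x.
  rewrite -[RHS]hsubmxK; congr row_mx; apply/rowP => k.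
  by rewrite ord1 !mxE -ord00.
have [|c cE] := gP (rsubmx x); first by rewrite xE.
by exists c; rewrite -linear_lincomb -{1}xE -linearB cE linear0.
Qed.

Lemma submodule_set_image (V W : lmodType A) (f : {linear V -> W}) (S : set V) :
  submodule_set S -> submodule_set (fun w => exists v, S v /\ f v = w).
Proof.
move=> [S0 SP]; split; first by exists 0; rewrite linear0.
move=> a _ _ [x [Sx <-]] [y [Sy <-]]; exists (a *: x + y); split; first exact: SP.
exact: linearP.
Qed.

End Noetherian.

Section FreeResolution.
Variables (A : pzRingType) (M : complex A).

Lemma fin_gen_cycles_modulo i i0 : i = i0 + 1 -> fin_gen (homology M i) ->
  fin_gen_modulo (fun m : M i => diff M i i0 m = 0)
    (fun m => exists y : M (i + 1), m = diff M (i + 1) i y).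
Proof.
move=> iE [n [g gP]].
have [z zE] := choice (fun k => homology_class_surj (g k)).
exists n, (fun k => cycle_val (z k)); split=> [k|m dm]; first exact: cyclesP.
have [m' mE] := mk_cycles iE dm.
have [c cE] := gP (homology_class m'); exists (\row_k c k).
have : homology_class m' = homology_class (lincomb z (\row_k c k)).
  rewrite cE -lincombE.
  apply: (big_ind2 (fun h y => h = homology_class y)).
  - by rewrite homology_class0.
  - by move=> h y h' y' -> ->; rewrite homology_classD.
  - by move=> k _; rewrite homology_classZ zE.
move=> /(homology_classP _ _ erefl)[y]; rewrite mE => ->; exists y.
rewrite addrAC [X in X - _](_ : _ = lincomb (fun k => cycle_val (z k)) (\row_k c k)).
  by rewrite subrr add0r.
apply: (big_ind2 (fun (h : cycles M i) y => cycle_val h = y)) => //.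
by move=> h w h' w' <- <-.
Qed.

(** When [Z] is the set of cycles of a partial resolution in degree [i] and [j = i + 1], these are,
    up to sign, the cycles of the mapping cone of [q] in degree [j]. *)
Definition cone_set i j n (Z : set 'rV[A]_n) (q : {linear 'rV[A]_n -> M i}) :
    set ('rV[A]_n * M j) :=
  fun w => Z w.1 /\ q w.1 = diff M j i w.2.

Lemma cone_set_submodule i j n (Z : set 'rV[A]_n) (q : {linear 'rV[A]_n -> M i}) :
  submodule_set Z -> submodule_set (@cone_set i j n Z q).
Proof.
move=> [Z0 ZP]; split; first by split; rewrite ?linear0.
move=> a [x m] [y m'] [/= Zx qx] [/= Zy qy].
by split; [exact: ZP | rewrite !linearP qx qy].
Qed.

(** The first components form a submodule of a free module of finite rank, finitely generated by
    noetherianity; the pairs with first component zero are the cycles of [M j], finitely generated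
    modulo boundaries by the homology hypothesis. *)
Lemma fin_gen_cone i j n (Z : set 'rV[A]_n) (q : {linear 'rV[A]_n -> M i}) :
  left_noetherian A -> j = i + 1 -> fin_gen (homology M j) -> submodule_set Z ->
  fin_gen_modulo (@cone_set i j n Z q)
    (fun w => w.1 = 0 /\ exists y : M (j + 1), w.2 = diff M (j + 1) j y).
Proof.
move=> AN jE Hj Zsub; have Ssub := @cone_set_submodule i j n Z q Zsub.
apply: (@fin_gen_extension _ _ _ (fst : {linear ('rV[A]_n * M j)%type -> 'rV[A]_n})) => //.
  by apply: left_noetherian_rV => //; exact: submodule_set_image.
have [r [g [gS gP]]] := fin_gen_cycles_modulo jE Hj.
exists r, (fun k => (0, g k)); split=> [k|[x m] /= [[Zx qx] x0]].
  by case: Zsub => Z0 _; split=> //=; rewrite /cone_set /= linear0 gS.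
have [|c [y yE]] := gP m; first by rewrite -qx x0 linear0.
exists c; rewrite x0.
have fst_comb :=
  linear_lincomb (fst : {linear ('rV[A]_n * M j)%type -> 'rV[A]_n}) (fun k => (0, g k)) c.
have snd_comb :=
  linear_lincomb (snd : {linear ('rV[A]_n * M j)%type -> M j}) (fun k => (0, g k)) c.
have w1 : (lincomb (fun k => ((0, g k) : 'rV[A]_n * M j)) c).1 = 0.
  by rewrite [LHS]fst_comb; apply: big1 => k _; rewrite scaler0.
split; first by rewrite -[LHS]/(0 - (lincomb _ c).1) w1 subr0.
by exists y; rewrite -yE -[LHS]/(m - (lincomb _ c).2) [X in _ - X]snd_comb.
Qed.

(* The stages of the construction of a free resolution: a rank n, the rows of
   the differential out of 'rV_n as a function nat -> nat -> A, and the images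
   in M i of the basis vectors.  Storing bare entries keeps the type of a stage
   independent of the ranks of its neighbours. *)
Record stage (i : int) := Stage {
  rank : nat;
  entries : nat -> nat -> A;
  images : nat -> M i
}.

Definition stage_diff i (z : stage i) m : {linear 'rV[A]_(rank z) -> 'rV[A]_m} :=
  lincomb (fun k : 'I_(rank z) => \row_(l < m) entries z k l).

Definition stage_map i (z : stage i) : {linear 'rV[A]_(rank z) -> M i} :=
  lincomb (fun k : 'I_(rank z) => images z k).

(** A stage does not record the rank of its target, so a cycle is asked to vanish for every width
    [m]. *)
Definition stage_cycle i (z : stage i) : set 'rV[A]_(rank z) :=
  fun x => forall m, stage_diff z m x = 0.

(** The second clause is exactness of the mapping cone, from which both halves of the
    quasi-isomorphism follow. The third says that the width [rank z] already detects cycles. *)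
Definition stage_step b i j (z : stage i) (z' : stage j) :=
  [/\ forall c, stage_cycle (stage_diff z' (rank z) c) /\
        stage_map z (stage_diff z' (rank z) c) = diff M j i (stage_map z' c),
      forall x m, stage_cycle x -> stage_map z x = diff M j i m ->
        exists c (y : M (j + 1)), x = stage_diff z' (rank z) c /\
          m = stage_map z' c + diff M (j + 1) j y,
      forall c, stage_diff z' (rank z) c = 0 -> stage_cycle c
    & j <= b -> rank z' = 0%N].

Lemma stage_cycle_submodule i (z : stage i) : submodule_set (@stage_cycle i z).
Proof.
split=> [m|a x y xc yc m]; first exact: linear0.
by rewrite linearP xc yc scaler0 addr0.
Qed.

Lemma rank0_rV i (z : stage i) (x y : 'rV[A]_(rank z)) : rank z = 0%N -> x = y.
Proof. by case: z x y => n D q /= x y n0; subst n; rewrite !thinmx0. Qed.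

Lemma stage_diffE i (z : stage i) m x l :
  stage_diff z m x 0 l = \sum_(k < rank z) x 0 k * entries z k l.
Proof. by rewrite /= /linear_combination summxE; apply: eq_bigr => k _; rewrite !mxE. Qed.

Lemma stage_step_down b i j (z : stage i) (z' : stage j) :
  j = i + 1 -> rank z = 0%N -> rank z' = 0%N -> exact_at M j ->
  stage_step b z z'.
Proof.
move=> jE z0 z'0 Mj; split=> // [c|x m _|c _].
- rewrite (rank0_rV c 0 z'0) !linear0; split=> // l; exact: linear0.
- rewrite (rank0_rV x 0 z0) linear0 => /esym dm.
  have [y yE] := Mj _ _ _ jE erefl dm.
  by exists 0, y; rewrite !linear0 add0r.
- by rewrite (rank0_rV c 0 z'0) => m; exact: linear0.
Qed.

(** Generators of the cone cycles modulo boundaries become the new basis: their first components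
    give the differential, their second components the map to [M]. *)
Lemma stage_step_up b i j (z : stage i) :
  left_noetherian A -> j = i + 1 -> fin_gen (homology M j) -> b < j ->
  exists z' : stage j, stage_step b z z'.
Proof.
move=> AN jE Hj bj.
have [r [g [gS gP]]] := fin_gen_cone (stage_map z) AN jE Hj (stage_cycle_submodule z).
(* Entries beyond the two ranks are zero, so no width larger than [rank z] imposes a new condition
   on cycles. *)
pose D k l := if (insub k : option 'I_r, insub l : option 'I_(rank z)) is (Some k', Some l')
  then (g k').1 0 l' else 0.
pose z' := Stage r D (fun k => if (insub k : option 'I_r) is Some k' then (g k').2 else 0).
have dE c : stage_diff z' (rank z) c = (lincomb g c).1.
  have -> := linear_lincomb (fst : {linear ('rV[A]_(rank z) * M j)%type -> 'rV[A]_(rank z)}) g c.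
  apply: eq_lincomb => k; apply/rowP => l.
  by rewrite !mxE /= /D !insubT // => kr lr; congr ((g _).1 0 _); exact: val_inj.
have mE c : stage_map z' c = (lincomb g c).2.
  have -> := linear_lincomb (snd : {linear ('rV[A]_(rank z) * M j)%type -> M j}) g c.
  apply: eq_lincomb => k /=.
  by rewrite insubT // => kr; congr ((g _).2); exact: val_inj.
have step c := submodule_lincomb c 
  (@cone_set_submodule _ j _ _ (stage_map z) (stage_cycle_submodule z)) gS.
exists z'; split=> [c|x m xc xm|c dc l|]; last by lia.
- by have [cyc qc] := step c; rewrite dE mE.
- have [|c /= [x0 [y yE]]] := gP (x, m); first by [].
  have xE : x = stage_diff z' (rank z) c.
    by rewrite dE; apply/eqP; rewrite -subr_eq0; apply/eqP.
  exists c, y; split; first exact: xE.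
  by rewrite [X in X + _](mE c) -yE [RHS]addrC subrK.
- apply/rowP => k; rewrite mxE stage_diffE.
  have [kr|rk] := ltnP k (rank z).
    by have /rowP/(_ (Ordinal kr)) := dc; rewrite mxE stage_diffE.
  apply: big1 => i0 _; rewrite /= /D; case: insub => [?|]; last by rewrite mulr0.
  by rewrite insubF ?mulr0 //; apply/negbTE; rewrite -leqNgt.
Qed.

Lemma free_resolution : left_noetherian A -> homologically_bounded M ->
  (forall v, fin_gen (homology M v)) ->
  exists P, is_proj_resolution P M /\ forall v, fin_gen (P v).
Proof.
move=> AN [b0 Mb] Hfg.
have [b Mlow] : exists b, forall v, v <= b -> exact_at M v.
  exists (- `|b0| - 1) => v vb; apply/homology_eq0; apply: Mb; lia.
pose z0 i := @Stage i 0 (fun _ _ => 0) (fun _ => 0).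
have [||i j jE bi z _|i j jE jb z zr|s _ sQ] := @int_rec stage
  (fun i z => i <= b -> rank z = 0%N) (@stage_step b) b (z0 b).
- by [].
- exact: z0.
- have [|z' z'P] := stage_step_up z AN jE (Hfg j) (b := b); first by lia.
  by exists z' => // jb; case: z'P => _ _ _; exact.
- exists (z0 i) => //; apply: stage_step_down => //; [exact: zr | exact: Mlow].
pose d i j : {linear 'rV[A]_(rank (s i)) -> 'rV[A]_(rank (s j))} :=
  if i == j + 1 then stage_diff (s i) (rank (s j)) else \0.
have dS i j : i != j + 1 -> forall x, d i j x = 0.
  by rewrite /d => /negPf ->.
have dE i j x : i = j + 1 -> d i j x = stage_diff (s i) (rank (s j)) x.
  by rewrite /d => /eqP ->.
have dK i j k x : d j k (d i j x) = 0.
  have [ij|/dS ->] := eqVneq i (j + 1); last by rewrite linear0.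
  have [jk|/dS ->//] := eqVneq j (k + 1).
  have [step _ _ _] := sQ j i ij.
  by rewrite dE // dE //; case: (step x) => cyc _; exact: cyc.
pose P : complex A := @Complex A (fun i => 'rV[A]_(rank (s i))) d dS dK.
have fC i j (x : P i) : stage_map (s j) (diff P i j x) = diff M i j (stage_map (s i) x).
  have [ij|ij] := eqVneq i (j + 1); last first.
    by rewrite !diff_shape // linear0.
  by have [step _ _ _] := sQ j i ij; rewrite /= dE //; case: (step x).
pose f : chain_map P M := ChainMap fC.
exists P; split; last by move=> v; exact: fin_gen_rV.
split; last 1 first.
- exists f; apply/quasi_isoP; split=> [v u w w' x y vu wv -> dx fx|v u w y vu wv dy].
    have [_ _ cyc _] := sQ u v vu; have [_ ex _ _] := sQ v w wv.
    have [|c [y' [xE _]]] := ex x y _ fx.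
      by apply: cyc; rewrite -dE.
    by exists c; rewrite /= dE.
  (* Surjectivity on homology is the cone condition at [x = 0]. *)
  have [_ ex _ _] := sQ u v vu.
  have [||c [y' [cE yE]]] := ex 0 y; first by move=> m; exact: linear0.
    by rewrite dy linear0.
  by subst w; exists c, y'; split; rewrite // /= dE.
- exists b => v vb x.
  have [_ _ _ r0] := sQ (v - 1) v ltac:(lia).
  by apply: rank0_rV; apply: r0; lia.
- by move=> v; exact: projective_rV.
Qed.

End FreeResolution.

(** * Vanishing of Ext *)

Section ExtVanish.
Variable A : pzRingType.

Lemma is_proj_resolution_chosen (P M : complex A) :
  is_proj_resolution P M -> is_proj_resolution (proj_resolution M) M.
Proof.
move=> PM; rewrite /proj_resolution; case: pselect => [MP|]; last by case; exists P.
exact: svalP (cid MP).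
Qed.

Lemma RHom_homology_eq0 (P M N : complex A) v : is_proj_resolution P M ->
  is_zero (homology (RHom M N) v) <-> null_at P N v.
Proof.
move=> PM; have QM := is_proj_resolution_chosen PM.
rewrite homology_eq0 exact_hom_complex.
by split; [exact: null_at_resolution PM QM | exact: null_at_resolution QM PM].
Qed.

(** Exactness of Hom([X], [N]) in cohomological degree [i]: every cocycle is a coboundary. *)
Definition ext_vanish (X : complex A) (N : lmodType A) (i : int) :=
  forall u w (f : {linear X i -> N}), i = u + 1 -> w = i + 1 ->
    (forall x, f (diff X w i x) = 0) ->
    exists g : {linear X u -> N}, forall x, f x = g (diff X i u x).

Lemma stalk_eq0 (N : lmodType A) i : i != 0 -> is_zero (stalk N i).
Proof. by case: i => [[|i]|i] // _ x; exact: thinmx0. Qed.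

Definition single_family (X Y : complex A) i j (f : {linear X i -> Y j}) : family X Y :=
  @dfwith _ (fun k => forall l, {linear X k -> Y l}) (zero_family X Y) i
    (dfwith (zero_family X Y i) j f).

Lemma single_familyE (X Y : complex A) i j (f : {linear X i -> Y j}) :
  single_family f i j = f.
Proof. by rewrite /single_family !dfwithin. Qed.

Lemma single_family_out (X Y : complex A) i j (f : {linear X i -> Y j}) k l :
  i != k -> single_family f k l = \0.
Proof. by move=> ik; rewrite /single_family dfwithout. Qed.

Lemma null_at_stalk (X : complex A) (N : lmodType A) i :
  null_at X (stalk N) (- i) <-> ext_vanish X N i.
Proof.
split=> [H u w f iu wi fd|H F FC].
  have [|s sE] := H (single_family (f : {linear X i -> stalk N 0})).
    move=> k l k' l' x kk' ll' lk /=.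
    have [k'i|ik'] := eqVneq i k'; last by rewrite single_family_out.
    have l'0 : l' = 0 by lia.
    have kw : k = w by lia.
    subst k' l' k w; rewrite single_familyE; exact/esym/fd.
  exists (s u 0) => x.
  have := sE i 0 u 1 x iu erefl ltac:(lia).
  by rewrite single_familyE /= add0r.
have [||g gE] := H (i - 1) (i + 1) (F i 0) _ erefl; first by rewrite subrK.
  move=> x; have <- := FC (i + 1) 1 i 0 x erefl erefl ltac:(lia).
  by [].
exists (single_family (g : {linear X (i - 1) -> stalk N 0})) => k l k' l' x kk' ll' lk.
have [l0|l0] := eqVneq l 0; last by rewrite (stalk_eq0 l0 (F k l x)) [RHS]stalk_eq0.
have ki : k = i by lia.
have k'E : k' = i - 1 by lia.
clear kk' ll' lk; subst k k' l; rewrite single_familyE.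
by rewrite [RHS]add0r gE.
Qed.

Lemma ext_vanish_zero_left (P : complex A) N i : is_zero (P i) -> ext_vanish P N i.
Proof. by move=> P0 u w f _ _ _; exists \0 => x; rewrite (P0 x) linear0. Qed.

Lemma ext_vanish_zero_right (P : complex A) N i : is_zero N -> ext_vanish P N i.
Proof. by move=> N0 u w f _ _ _; exists \0 => x; exact: N0. Qed.

Lemma ext_vanish_rV (P : complex A) n i :
  ext_vanish P A^o i -> ext_vanish P 'rV[A]_n i.
Proof.
move=> PA u w f iu wi fd.
have coordL k : linear (fun x : 'rV[A]_n => x 0 k : A^o).
  by move=> a x y; rewrite !mxE.
have ex k : exists g : {linear P u -> A^o}, forall x, f x 0 k = g (diff P i u x).
  apply: (PA u w (lin_of (coordL k) \o f)) => // x.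
  by rewrite /= fd mxE.
have [g gE] := choice ex.
have gL : linear (fun x => \row_k g k x).
  by move=> a x y; apply/rowP => k; rewrite !mxE linearP.
by exists (lin_of gL) => x; apply/rowP => k; rewrite mxE gE.
Qed.

(** Exactness passes from [A] to finite free modules coordinatewise, and from there to their
    retracts. *)
Lemma ext_vanish_projective (P : complex A) (N : lmodType A) i :
  fin_gen N -> projective N -> ext_vanish P A^o i -> ext_vanish P N i.
Proof.
move=> Nfg Nproj PA u w f iu wi fd.
have [n [a [p ap]]] := fin_gen_proj_retract Nfg Nproj.
have [|g gE] := ext_vanish_rV PA (f := a \o f) iu wi (n := n).
  by move=> x; rewrite /= fd linear0.
by exists (p \o g) => x; rewrite /= -gE /= ap.
Qed.

Section Cycles.
Variable X : complex A.

Fact cycle_val_linear u : linear (@cycle_val _ X u).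
Proof. by []. Qed.

Definition cycle_incl u : {linear cycles X u -> X u} := lin_of (@cycle_val_linear u).

Lemma cycle_inclP u t (z : cycles X u) : u = t + 1 -> diff X u t (cycle_incl u z) = 0.
Proof. exact: cyclesP. Qed.

Lemma cycle_incl_inj u : injective (cycle_incl u).
Proof. exact: val_inj. Qed.

Lemma cycles_lift (W : lmodType A) u (h : {linear W -> X u}) :
  (forall t w, u = t + 1 -> diff X u t (h w) = 0) ->
  exists k : {linear W -> cycles X u}, forall w, cycle_incl u (k w) = h w.
Proof.
move=> dh.
have hk w : h w \in @cycle_pred _ X u.
  by apply/eqP; apply: dh; rewrite subrK.
have kL : linear (fun w => Cycles (hk w)).
  by move=> a x y; apply: val_inj => /=; rewrite linearP.
by exists (lin_of kL).
Qed.

Lemma cycles_cover w u : w = u + 1 -> exact_at X u ->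
  exists k : {linear X w -> cycles X u},
    (forall x, cycle_incl u (k x) = diff X w u x) /\ forall z, exists x, k x = z.
Proof.
move=> wu Xu; have [|k kE] := @cycles_lift _ u (diff X w u).
  by move=> t x _; exact: diffK.
exists k; split=> // z.
have [||y yE] := Xu (u - 1) w (cycle_incl u z) _ wu.
- by rewrite subrK.
- by apply: cycle_inclP; rewrite subrK.
by exists y; apply: cycle_incl_inj; rewrite kE.
Qed.

End Cycles.

Section Truncation.
Variables (P : complex A) (n : int).

(** The part of [P] in degrees at least [n], shifted so that [P n] sits in degree 0. *)
Definition trunc_obj (k : int) : lmodType A :=
  match k with Posz m => P (n + m%:Z) | Negz _ => 'rV[A]_0 end.

Definition trunc_diff i j : {linear trunc_obj i -> trunc_obj j} :=
  match i, j return {linear trunc_obj i -> trunc_obj j} with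
  | Posz a, Posz b => diff P (n + a%:Z) (n + b%:Z)
  | _, _ => \0
  end.

Fact trunc_diff_shape i j : i != j + 1 -> forall x, trunc_diff i j x = 0.
Proof.
case: i j => i [] j //= ij x; rewrite diff_shape //.
by apply: contra ij => /eqP ij; apply/eqP; lia.
Qed.

Fact trunc_diffK i j k x : trunc_diff j k (trunc_diff i j x) = 0.
Proof. by case: i j k x => i [] j [] k //= x; rewrite ?linear0 // diffK. Qed.

Definition trunc := Complex trunc_diff_shape trunc_diffK.

Lemma trunc_resolution u : (forall v, projective (P v)) -> n = u + 1 ->
  (forall v, u <= v -> exact_at P v) ->
  is_proj_resolution trunc (stalk (cycles P u)).
Proof.
move=> Pproj nu Pex.
have n0u : n + 0%N%:Z = u + 1 by lia.
have [k0 [k0E k0s]] := cycles_cover n0u (Pex u (lexx u)).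
split.
- by exists 0 => -[] // v _ x; exact: thinmx0.
- by case=> v; [exact: Pproj | exact: projective_rV].
pose f i : {linear trunc i -> stalk (cycles P u) i} :=
  match i return {linear trunc i -> stalk (cycles P u) i} with
  | Posz 0 => k0 | _ => \0 end.
have fC i j x : f j (diff trunc i j x) = diff (stalk (cycles P u)) i j (f i x).
  case: j => [[|j]|j] //=; case: i x => [i|i] x /=; rewrite ?linear0 //.
  by apply: cycle_incl_inj; rewrite k0E diffK linear0.
exists (ChainMap fC); apply/quasi_isoP; split=> [v t w w' x y vt wv -> dx fx|v t w y vt wv dy].
  case: v x vt wv dx fx => [v|v] x vt wv dx fx; last first.
    by exists 0; rewrite linear0; exact: (thinmx0 (x : 'rV[A]_0)).
  have wE : w = v.+1%N by lia.
  have [|y' yE] := Pex (n + v%:Z) ltac:(lia) (n + v%:Z - 1) (n + v.+1%:Z) x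
    ltac:(lia) ltac:(lia).
    case: v x vt wv dx fx {wE} => [|v] x vt wv dx fx.
      have uE : n + 0%N%:Z - 1 = u by lia.
      have k0x : k0 x = 0 by exact: fx.
      by have := k0E x; rewrite k0x linear0 -uE => /esym.
    have tE : t = v by lia.
    subst t; have tE : n + v.+1%:Z - 1 = n + v%:Z by lia.
    by move: dx; rewrite /= tE.
  by clear fx y wv; subst w; exists y'.
case: v y vt wv dy => [[|v]|v] y vt wv dy.
- have [x xE] := k0s y; exists x, 0; split; last by rewrite linear0 addr0.
  by have -> : t = Negz 0 by lia.
- by exists 0, 0; split; [rewrite linear0 |
    exact: etrans (thinmx0 (y : 'rV[A]_0)) (esym (thinmx0 _))].
- by exists 0, 0; split; [rewrite linear0 |
    exact: etrans (thinmx0 (y : 'rV[A]_0)) (esym (thinmx0 _))].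
Qed.

Lemma ext_vanish_trunc N (i : nat) :
  ext_vanish trunc N i.+1%:Z <-> ext_vanish P N (n + i.+1%:Z).
Proof.
split=> H u w f iu wi fd.
  have uE : u = n + i%:Z by lia.
  have wE : w = n + i.+2%:Z by lia.
  clear iu wi; subst u w.
  exact: (H i%:Z i.+2%:Z f ltac:(lia) ltac:(lia) fd).
have uE : u = i%:Z by lia.
have wE : w = i.+2%:Z by lia.
clear iu wi; subst u w.
exact: (H (n + i%:Z) (n + i.+2%:Z) f ltac:(lia) ltac:(lia) fd).
Qed.

End Truncation.

(** The truncation of [P] at [n = u + 1] resolves the cycles in degree [u]. The degree [i.+1] is
    positive because in degree 0 the truncation has lost the differential out of [P n]. *)
Lemma Ext_cycles (P : complex A) (N : lmodType A) u n (i : nat) :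
  (forall v, projective (P v)) -> n = u + 1 ->
  (forall v, u <= v -> exact_at P v) ->
  is_zero (Ext i.+1 (cycles P u) N) <-> ext_vanish P N (n + i.+1%:Z).
Proof.
move=> Pproj nu Pex.
rewrite -ext_vanish_trunc -null_at_stalk.
rewrite -(RHom_homology_eq0 _ _ (trunc_resolution Pproj nu Pex)).
by [].
Qed.

End ExtVanish.

(** * Syzygies and splitting *)

Section Syzygies.
Variables (A : pzRingType) (P : complex A).
Hypothesis Pproj : forall v, projective (P v).

(* A cocycle P_j -> Z_u is extended to a chain endomorphism of P of degree
   u + 1 - j: upwards by exactness, downwards by the vanishing of Ext into the
   modules P_k; a null homotopy of it exhibits the cocycle as a coboundary. *)
Lemma ext_vanish_cycles u n j : n = u + 1 -> (forall v, u <= v -> exact_at P v) ->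
  null_at P P (n - j) ->
  (forall i k, i <= j -> k = i + (n - j) - 1 -> ext_vanish P (P k) i) ->
  ext_vanish P (cycles P u) j.
Proof.
move=> nu Pex Pnull PE t w f jt wj fd; pose v := n - j.
have jv : n = j + v by rewrite /v; lia.
have [f0 f0E] : exists f0 : {linear P j -> P n},
    forall x, diff P n u (f0 x) = cycle_incl P u (f x).
  apply: (projective_lift (g := diff P n u) (h := cycle_incl P u \o f)) => // x.
  have [||y yE] := Pex u (lexx u) (u - 1) n (cycle_incl P u (f x)) _ nu.
  - by rewrite subrK.
  - by apply: cycle_inclP; rewrite subrK.
  by exists y.
(* [G] lets the chosen component extend one degree upwards, and [Q] is commutation with the
   differentials. *)
pose F i : Type := forall k, {linear P i -> P k}.
pose G i (z : F i) := forall i1 k k' (p : P i1), i1 = i + 1 -> k = i + v -> k = k' + 1 ->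
  diff P k k' (z k (diff P i1 i p)) = 0.
pose Q i j (z : F i) (z' : F j) := forall k k' p, k = j + v -> k = k' + 1 ->
  diff P k k' (z' k p) = z k' (diff P j i p).
have [||i i1 i1E ji z Gz|i i1 i1E ij z Gz|s s0 sQ] :=
  @int_rec F G Q j (dfwith (zero_family P P j) n f0).
- move=> i1 k k' p i1E kE k'E.
  have kn : k = n by lia.
  have k'u : k' = u by lia.
  have i1w : i1 = w by lia.
  by clear i1E kE k'E; subst k k' i1; rewrite dfwithin f0E fd linear0.
- by move=> i k; exact: \0.
- have [k1 k1E] : exists k1, k1 = i1 + v by exists (i1 + v).
  have [k kE] : exists k, k = i + v by exists (i + v).
  have [|y yE] := projective_lift (g := diff P k1 k) (h := z k \o diff P i1 i) (@Pproj i1).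
    move=> x; have [|y yE] := Pex k ltac:(lia) (k - 1) k1 (z k (diff P i1 i x))
      ltac:(lia) ltac:(lia); first by apply: Gz; rewrite // subrK.
    by exists y.
  have Qz : Q i i1 z (dfwith (zero_family P P i1) k1 y).
    move=> l l' p lE l'E; have lk1 : l = k1 by lia.
    have l'k : l' = k by lia.
    by clear lE l'E; subst l l'; rewrite dfwithin yE.
  exists (dfwith (zero_family P P i1) k1 y) => // i2 l l' p i2E lE l'E.
  by rewrite (Qz l l') // diffK linear0.
- have [k1 k1E] : exists k1, k1 = i1 + v by exists (i1 + v).
  have [k kE] : exists k, k = i + v by exists (i + v).
  have [||y yE] := PE i1 k ij _ i (i1 + 1) (diff P k1 k \o z k1) i1E erefl; first by lia.
    by move=> x; apply: Gz; lia.
  have Qz : Q i i1 (dfwith (zero_family P P i) k y) z.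
    move=> l l' p lE l'E; have lk1 : l = k1 by lia.
    have l'k : l' = k by lia.
    by clear lE l'E; subst l l'; rewrite dfwithin -yE.
  exists (dfwith (zero_family P P i) k y) => // i2 l l' p i2E lE l'E.
  have lk : l = k by lia.
  have i2i : i2 = i1 by lia.
  clear i2E lE l'E; subst l i2; rewrite dfwithin -yE /=; exact: diffK.
have [|h hE] := Pnull s.
  move=> i k i' k' x iE kE ki.
  by have := sQ i' i iE k k' x ki kE.
(* The homotopy gives [f0 = d h + h d] on [P j]; composing with [d] leaves [f = d h d], so [d h] is
   the required cochain. *)
have [|g gE] := cycles_lift (h := diff P n u \o h t n).
  by move=> l x _; exact: diffK.
exists g => x; apply: cycle_incl_inj; rewrite -f0E gE /=.
have := hE j n t (n + 1) x jt erefl ltac:(lia).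
by rewrite s0 dfwithin => ->; rewrite linearD diffK add0r.
Qed.

(** This is the long exact sequence for the extension of the cycles in degree [u] by the cycles in
    degree [w], with middle term [P w]. Concretely, [f = g d] in [P w], then [d g = h d], and for a
    lift [h'] of [h] the map [g - h' d] lands in the cycles and still restricts to [f]. *)
Lemma ext_vanish_shift u w i j : w = u + 1 -> j = i + 1 -> exact_at P u ->
  ext_vanish P (P w) j -> ext_vanish P (cycles P u) i -> ext_vanish P (cycles P w) j.
Proof.
move=> wu ji Pu PE CE i0 j1 f ji0 j1j fd.
have i0i : i0 = i by lia.
subst i0; have [|g gE] := PE i j1 (cycle_incl P w \o f) ji j1j.
  by move=> x; rewrite /= fd.
have [|k kE] := cycles_lift (h := diff P w u \o g).
  by move=> t x _; exact: diffK.
have [||h hE] := CE (i - 1) j k _ ji; first by rewrite subrK.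
  move=> x; apply: cycle_incl_inj; rewrite kE /= -gE.
  exact: cycle_inclP.
have [h' h'E] : exists h' : {linear P (i - 1) -> P w},
    forall x, diff P w u (h' x) = cycle_incl P u (h x).
  apply: (projective_lift (g := diff P w u) (h := cycle_incl P u \o h)) => // x.
  have [||y yE] := Pu (u - 1) w (cycle_incl P u (h x)) _ wu.
  - by rewrite subrK.
  - by apply: cycle_inclP; rewrite subrK.
  by exists y.
have [|l lE] := cycles_lift (h := g \- (h' \o diff P i (i - 1))).
  move=> t x wt; have tu : t = u by lia.
  by subst t; rewrite linearB /= h'E -hE kE subrr.
exists l => x; apply: cycle_incl_inj.
by rewrite lE /= diffK linear0 subr0 -gE.
Qed.

End Syzygies.

Section Splitting.
Variables (A : pzRingType).

(** The map [e] is an idempotent of [P k] whose image is the module of boundaries, so the boundaries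
    are a direct summand. *)
Definition splits_at (P : complex A) k := (forall v, k < v -> exact_at P v) /\
  exists e : {linear P k -> P k}, forall w, w = k + 1 ->
    (forall x, exists y, e x = diff P w k y) /\
    (forall y, e (diff P w k y) = diff P w k y).

(** The cover of the cycles in degree [k] by [P (k + 1)] is a cocycle; writing it as a coboundary
    [g d] makes [g] a retraction of [P k] onto the cycles, which are the boundaries. *)
Lemma splits_at_start (P : complex A) k : (forall v, k <= v -> exact_at P v) ->
  ext_vanish P (cycles P k) (k + 1) -> splits_at P k.
Proof.
move=> Pex PE; split; first by move=> v /ltW; exact: Pex.
have [d [dE _]] := cycles_cover erefl (Pex k (lexx k)).
have [|g gE] := PE k _ d erefl erefl.
  by move=> x; apply: cycle_incl_inj; rewrite dE diffK linear0.
exists (cycle_incl P k \o g) => w wk; split=> [x|y].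
  have [||y yE] := Pex k (lexx k) (k - 1) w (cycle_incl P k (g x)) _ wk.
  - by rewrite subrK.
  - by apply: cycle_inclP; rewrite subrK.
  by exists y.
by subst w; rewrite /= -gE; exact: dE.
Qed.

(** The map [1 - e] kills boundaries, hence is a cocycle and equals [g d] for some [g]. A cycle [z]
    then satisfies [z = e z], which gives exactness at [k], and [d g] is the idempotent in degree
    [j]. *)
Lemma splits_at_pred (P : complex A) k j : k = j + 1 ->
  projective (P k) -> fin_gen (P k) -> ext_vanish P A^o k ->
  splits_at P k -> splits_at P j.
Proof.
move=> kj Pproj Pfg PA [Pex [e eP]].
have [eB eK] := eP (k + 1) erefl.
have [|g gE] := ext_vanish_projective Pfg Pproj PA (f := idfun \- e) kj erefl.
  by move=> x; rewrite /= eK subrr.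
split.
  move=> v jv; have [kv|vk] := ltP k v; first exact: Pex.
  have vk' : v = k by lia.
  subst v => u w z kju wv dz; have uj : u = j by lia.
  subst u w; have [y yE] := eB z; exists y.
  have /eqP := gE z; rewrite dz linear0 /= subr_eq0 => /eqP zE.
  by rewrite -yE.
exists (diff P k j \o g) => w wj; have wk : w = k by lia.
clear wj; subst w; split=> [x|y]; first by exists (g x).
rewrite /= -gE /= linearB; have [y' ->] := eB y.
by rewrite diffK subr0.
Qed.

Lemma quasi_iso_comp (X Y Z : complex A) (f : chain_map X Y) (g : chain_map Y Z)
    (h : chain_map X Z) : (forall i x, h i x = g i (f i x)) ->
  quasi_iso f -> quasi_iso g -> quasi_iso h.
Proof.
move=> hE /quasi_isoP[finj fsurj] /quasi_isoP[ginj gsurj]; apply/quasi_isoP; split.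
  move=> v u w w' x y vu wv w'w dx hx.
  have [||y' y'E] := ginj v u w w (f v x) y vu wv erefl.
  - by rewrite -chain_funC dx linear0.
  - by rewrite -hE.
  exact: (finj v u w w' x y' vu wv w'w dx y'E).
move=> v u w z vu wv dz.
have [y [z' [dy zE]]] := gsurj v u w z vu wv dz.
have [x [y' [dx yE]]] := fsurj v u w y vu wv dy.
exists x, (g w y' + z'); split=> //.
by rewrite zE yE hE !linearD -chain_funC addrA.
Qed.

(** The truncation is the subcomplex equal to [P] below [k], to a complement of the boundaries in
    degree [k], and to zero above; its terms are retracts of those of [P]. *)
Lemma splits_at_resolution (P M : complex A) k :
  is_proj_resolution P M -> splits_at P k ->
  exists P', [/\ is_proj_resolution P' M, forall v, k < v -> is_zero (P' v)
    & forall v, is_zero (P v) -> is_zero (P' v)].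
Proof.
move=> [[b Pb] Pproj [q qq]] [Pex [e0 e0P]].
(* One family of idempotents, 0 below [k] and the identity above, presents the whole subcomplex as a
   degreewise kernel. *)
have [e [elt ek egt]] : exists e : forall v, {linear P v -> P v},
   [/\ forall v, v < k -> forall x, e v x = 0, forall x, e k x = e0 x
     & forall v, k < v -> forall x, e v x = x].
  pose e (v : int) : {linear P v -> P v} :=
    if (v < k)%R then \0 : {linear P v -> P v} else idfun : {linear P v -> P v}.
  exists (dfwith e k e0); split=> [v vk x|x|v kv x].
  - by rewrite dfwithout ?gt_eqF // /e vk.
  - by rewrite dfwithin.
  - by rewrite dfwithout ?lt_eqF // /e ltNge (ltW kv).
have [e0B e0K] := e0P (k + 1) erefl.
have eK v x : e v (e v x) = e v x.
  have [vk|kv|vk] := ltgtP v k; first by rewrite !elt.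
    by rewrite !egt.
  by subst v; rewrite !ek; have [y ->] := e0B x.
have de v u x : v = u + 1 -> v <= k -> diff P v u (e v x) = 0.
  move=> vu; rewrite le_eqVlt => /orP[/eqP vk|vk]; last by rewrite elt ?linear0.
  by subst k; rewrite ek; have [y ->] := e0B x; exact: diffK.
pose K v : lmodType A := ker (e v).
have ed i j (x : K i) : e j (diff P i j (ker_incl (e i) x)) = 0.
  have [ij|ij] := eqVneq i (j + 1); last by rewrite diff_shape ?linear0.
  have [jk|kj] := ltP j k; first by rewrite elt.
  have ki : k < i by lia.
  by rewrite -(egt i ki (ker_incl (e i) x)) ker_inclP !linear0.
have dex i j := ker_lift (h := diff P i j \o ker_incl (e i)) (@ed i j).
pose d i j : {linear K i -> K j} := sval (cid (dex i j)).
have dE i j x : ker_incl (e j) (d i j x) = diff P i j (ker_incl (e i) x).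
  exact: (svalP (cid (dex i j)) x).
have dS i j : i != j + 1 -> forall x, d i j x = 0.
  by move=> ij x; apply: ker_incl_inj; rewrite dE diff_shape // linear0.
have dK i j l x : d j l (d i j x) = 0.
  by apply: ker_incl_inj; rewrite !dE diffK linear0.
pose P' : complex A := Complex dS dK.
have iC i j (x : P' i) : ker_incl (e j) (diff P' i j x) = diff P i j (ker_incl (e i) x).
  exact: dE.
pose i : chain_map P' P := @ChainMap _ P' P (fun v => ker_incl (e v)) iC.
have proj v x : exists x' : K v, ker_incl (e v) x' = x - e v x.
  have xk : x - e v x \in ker_pred (e v).
    by rewrite unfold_in linearB eK subrr.
  by exists (Ker xk).
exists P'; split.
- split.
  + by exists b => v vb x; apply: ker_incl_inj; rewrite (Pb v vb (ker_incl _ x)) linear0.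
  + move=> v; have [|p pE] := ker_lift (f := e v) (h := idfun \- e v).
      by move=> x; rewrite /= linearB eK subrr.
    apply: (projective_retract (i := ker_incl (e v)) (p := p)) => // x.
    by apply: ker_incl_inj; rewrite pE /= [e v _]ker_inclP subr0.
  have qiC u v (x : P' u) : q v (i v (diff P' u v x)) = diff M u v (q u (i u x)).
    by rewrite !chain_funC.
  exists (@ChainMap _ P' M (fun v => q v \o i v) qiC).
  apply: (quasi_iso_comp (f := i) (g := q)) => //; apply/quasi_isoP; split.
    move=> v u w w' x y vu wv -> dx /= xE.
    have [kv|vk] := ltP k v.
      exists 0; apply: ker_incl_inj; rewrite !linear0.
      by rewrite -(egt v kv (ker_incl _ x)) ker_inclP.
    have [vk'|vk'] := eqVneq v k.
      clear vu dx; subst v; exists 0; apply: ker_incl_inj; rewrite !linear0.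
      have := ker_inclP x; rewrite /= xE ek; subst w.
      by rewrite e0K.
    have [x' x'E] := proj w y; exists x'; apply: ker_incl_inj.
    by rewrite [LHS]xE dE x'E linearB de ?subr0 //; lia.
  move=> v u w y vu wv dy.
  have [kv|vk] := ltP k v.
    have [y' y'E] := Pex v kv u w y vu wv dy.
    by exists 0, y'; rewrite !linear0 add0r.
  have [x xE] := proj v y.
  have [y' y'E] : exists y', e v y = diff P w v y'.
    have [vk'|vk'] := eqVneq v k; last first.
      by exists 0; rewrite linear0 elt //; lia.
    by clear vu dy xE; subst v w; rewrite ek.
  exists x, y'; split; last by rewrite [i v x]xE -y'E subrK.
  by apply: ker_incl_inj; rewrite dE xE linearB dy de // subr0 linear0.
- move=> v kv x; apply: ker_incl_inj; rewrite linear0.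
  by rewrite -(egt v kv (ker_incl _ x)) ker_inclP.
- by move=> v Pv x; apply: ker_incl_inj; rewrite (Pv (ker_incl _ x)) linear0.
Qed.

End Splitting.

(** * Projective dimension *)

Section Suprema.

Lemma supremum_max (S : set int) p : S p -> (forall v, S v -> v <= p) ->
  supremum -oo%E (EFin @` S)%classic = p%:E.
Proof.
move=> Sp Sle; rewrite /supremum ifF; last first.
  by apply/eqP => /seteqP[/(_ p%:E) + _]; apply; exists p.
apply: xget_unique => [|y [yub ylub]].
  split=> [_ [v Sv <-]|y]; first by rewrite lee_fin Sle.
  by apply; exists p.
apply/eqP; rewrite eq_le; apply/andP; split; last by apply: yub; exists p.
by apply: ylub => _ [v Sv <-]; rewrite lee_fin Sle.
Qed.

Lemma infimum_min d (T : porderType d) (x0 : T) (S : set T) m :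
  S m -> (forall s, S s -> (m <= s)%O) -> infimum x0 S = m.
Proof.
move=> Sm mle; rewrite /infimum ifF; last first.
  by apply/eqP => /seteqP[/(_ m) + _]; apply.
apply: xget_unique => [|y [ylb yglb]]; first by split=> // y; apply.
by apply/eqP; rewrite eq_le ylb //= yglb.
Qed.

Lemma int_max (S : set int) (b : int) : (exists v, S v) -> (forall v, S v -> v <= b) ->
  exists2 p, S p & forall v, S v -> v <= p.
Proof.
move=> [v0 Sv0] Sb.
pose Q (n : nat) := `[< S (b - n%:Z) >].
have [|n /asboolP Sn nmin] := @ex_minnP Q.
  exists `|b - v0|%N; apply/asboolP.
  by have -> : b - `|b - v0|%N%:Z = v0 by have := Sb _ Sv0; lia.
exists (b - n%:Z) => // v Sv; have vb := Sb _ Sv.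
have : (n <= `|b - v|)%N.
  by apply: nmin; apply/asboolP; have -> : b - `|b - v|%N%:Z = v by lia.
lia.
Qed.

(** [supremum] is a choice among least upper bounds, so one must be shown to exist: a maximum if [S]
    is bounded above, [+oo] otherwise. *)
Lemma le_supremum (S : set int) p : S p -> (p%:E <= supremum -oo (EFin @` S)%classic)%E.
Proof.
move=> Sp; have [[b Sb]|unb] := pselect (exists b, forall v, S v -> v <= b).
  have [q Sq qmax] := int_max (ex_intro _ p Sp) Sb.
  by rewrite (supremum_max Sq qmax) lee_fin qmax.
have : supremums (EFin @` S)%classic (supremum -oo%E (EFin @` S)%classic).
  rewrite /supremum ifF; last first.
    by apply/eqP => /seteqP[/(_ p%:E) + _]; apply; exists p.
  apply: xgetPex; exists +oo%E; split=> [y _|y yub]; first exact: leey.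
  case: y yub => [r|//|] yub.
    by exfalso; apply: unb; exists r => v Sv; rewrite -lee_fin; apply: yub; exists v.
  by have := yub p%:E (ex_intro2 _ _ p Sp erefl); rewrite leeNy_eq.
by case=> ub _; apply: ub; exists p.
Qed.

End Suprema.

Section ProjectiveDimension.
Variables (A : pzRingType) (M : complex A).

(** Every resolution [Q] of [M] computes the nonzero cohomology in degree [p], so [Q p] is nonzero
    and [Q] cannot be shorter. *)
Lemma pd_max p : (exists2 P, is_proj_resolution P M & forall v, p < v -> is_zero (P v)) ->
  ~ is_zero (homology (RHom M (stalk A^o)) (- p)) -> pd M = p%:E.
Proof.
move=> [P PM Pp] Mp.
have nz Q : is_proj_resolution Q M -> ~ is_zero (Q p).
  move=> QM Q0; apply: Mp.
  by apply/(RHom_homology_eq0 _ _ QM)/null_at_stalk; exact: ext_vanish_zero_left.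
apply: infimum_min => [|_ [Q QM ->]]; last by apply: le_supremum; exact: nz.
exists P => //; apply/esym/supremum_max; first exact: nz.
by move=> v Pv; rewrite leNgt; apply/negP => /Pp.
Qed.

Lemma pd_zero P : is_proj_resolution P M -> (forall v, is_zero (P v)) -> pd M = -oo%E.
Proof.
move=> PM P0; apply: infimum_min => [|s _]; last exact: leNye.
exists P => //; rewrite /supremum ifT //; apply/eqP/seteqP; split=> // x [v Pv _].
exact: Pv.
Qed.

Lemma inf_homology_min (X : complex int) p : ~ is_zero (homology X p) ->
  (forall v, v < p -> is_zero (homology X v)) -> inf_homology X = p%:E.
Proof.
move=> Xp Xlt; apply: infimum_min; first by exists p.
by move=> _ [v Xv <-]; rewrite lee_fin leNgt; apply/negP => /Xlt.
Qed.

Lemma inf_homology_zero (X : complex int) :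
  (forall v, is_zero (homology X v)) -> inf_homology X = +oo%E.
Proof.
move=> X0; rewrite /inf_homology /infimum ifT //.
by apply/eqP/seteqP; split=> // x [v Xv _]; exact: Xv.
Qed.

Lemma splits_at_descend P k p : is_proj_resolution P M -> (forall v, fin_gen (P v)) ->
  splits_at P k -> (forall i, p < i -> ext_vanish P A^o i) -> p <= k -> splits_at P p.
Proof.
move=> [_ Pproj _] Pfg Pk PE pk.
have -> : p = k - `|k - p|%N%:Z by lia.
(* The bound on the number of steps is kept through the induction, so that every degree left behind
   exceeds [p]. *)
have : (`|k - p| <= `|k - p|)%N by [].
elim: {1 3}`|k - p|%N => [|m IH] mk; first by rewrite subr0.
apply: (splits_at_pred (k := k - m%:Z)) => //; [lia|apply: PE; lia|].
by apply: IH; lia.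
Qed.

End ProjectiveDimension.

Section Bounded.
Variables (A : pzRingType) (P : complex A).
Hypotheses (AC : condition_AC A) (Pfg : forall v, fin_gen (P v)).
Hypothesis Pproj : forall v, projective (P v).

Lemma ext_vanish_syzygies u b : (exists a, forall v, v < a -> is_zero (P v)) ->
  (forall v, u <= v -> exact_at P v) ->
  (forall v, b < `|v| -> null_at P P v) ->
  (forall i, b < i -> ext_vanish P A^o i) ->
  forall m : nat, exists J : int, forall j, J <= j -> ext_vanish P (cycles P (u + m%:Z)) j.
Proof.
move=> [a Pa] Pex Pnull PA; elim=> [|m [J JP]].
  (* For such [j] the degree [u + 1 - j] of the chain endomorphism is below [- b], and a component
     out of [P i] with [i <= b] has to be handled only in degrees below [a], where [P] vanishes. *)
  exists (u + 1 + `|b| + 1 + `|a|%:Z + `|u|%:Z) => j jJ.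
  rewrite addr0; apply: (@ext_vanish_cycles _ _ Pproj u (u + 1)) => //.
    by apply: Pnull; lia.
  move=> i k ij kE; have [bi|ib] := ltP b i.
    by apply: ext_vanish_projective => //; exact: PA.
  by apply: ext_vanish_zero_right; apply: Pa; lia.
exists (`|J| + `|b| + 2) => j jJ.
apply: (@ext_vanish_shift _ _ Pproj (u + m%:Z) _ (j - 1)) => //; try lia.
- by apply: Pex; lia.
- by apply: ext_vanish_projective => //; apply: PA; lia.
- by apply: JP; lia.
Qed.

Lemma eventually_splits u b : (exists a, forall v, v < a -> is_zero (P v)) ->
  (forall v, u <= v -> exact_at P v) ->
  (forall v, b < `|v| -> null_at P P v) ->
  (forall i, b < i -> ext_vanish P A^o i) -> exists k, splits_at P k.
Proof.
move=> Pa Pex Pnull PA.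
have cycles_fg v : u <= v -> fin_gen (cycles P v).
  move=> uv; have [k [_ ks]] := cycles_cover erefl (Pex v uv).
  exact: fin_gen_surj ks (@Pfg _).
have [beta ACu] := AC (cycles_fg u (lexx u)).
(* The bound [beta] depends only on the cycles in degree [u], so the syzygy used as second argument
   may be chosen after it. With this [k], degree [k + 1] of Hom([P], -) computes [Ext] of those
   cycles in degree [beta.+1], the first one covered by (AC). *)
pose k := u + beta.+1%:Z.
exists k; apply: splits_at_start => [v kv|]; first by apply: Pex; lia.
have kE : k + 1 = u + 1 + beta.+1%:Z by lia.
rewrite kE; apply/(Ext_cycles _ _ Pproj erefl Pex).
apply: ACu => //; first by apply: cycles_fg; lia.
have [J JP] := ext_vanish_syzygies Pa Pex Pnull PA beta.+1.
exists (`|J| + `|u|)%N => -[|i] // Ji.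
by apply/(Ext_cycles _ _ Pproj erefl Pex)/JP; lia.
Qed.

End Bounded.

(** * Proof of the formula for the projective dimension *)

Lemma null_at_dsum (A : pzRingType) (P X Y : complex A) v :
  null_at P (dsum X Y) v -> null_at P X v /\ null_at P Y v.
Proof.
move=> H; split=> f fC.
  have [|s sE] := H (fun i j => pair_map (f i j) \0).
    by move=> i j i' j' x iE jE ji; congr (_, _); rewrite ?linear0 //; exact: fC.
  exists (fun i j => fst \o s i j) => i j i' j' x iE jE ji.
  by have /(congr1 fst) := sE i j i' j' x iE jE ji.
have [|s sE] := H (fun i j => pair_map \0 (f i j)).
  by move=> i j i' j' x iE jE ji; congr (_, _); rewrite ?linear0 //; exact: fC.
exists (fun i j => snd \o s i j) => i j i' j' x iE jE ji.
by have /(congr1 snd) := sE i j i' j' x iE jE ji.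
Qed.

Lemma exact_at_quasi_iso (R : pzRingType) (X Y : complex R) (f : chain_map X Y) v :
  quasi_iso f -> exact_at Y v -> exact_at X v.
Proof.
move=> /quasi_isoP[finj _] Yv u w x vu wv dx.
have [|y yE] := Yv u w (f v x) vu wv; first by rewrite -chain_funC dx linear0.
have [x' ->] := finj v u w w x y vu wv erefl dx (esym yE).
by exists x'.
Qed.

Theorem theorem2p3 (A : pzRingType) (M : complex A) :
  left_noetherian A ->
  condition_AC A ->
  homologically_bounded M ->
  (forall v : int, fin_gen (homology M v)) ->
  homologically_bounded (RHom M (dsum M (stalk A^o))) ->
  pd M = (- inf_homology (RHom M (stalk A^o)))%E /\
  (- inf_homology (RHom M (stalk A^o)) < +oo)%E.
Proof.
move=> AN AC [c Mc] Mfg [b RHomb].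
have [P [PM Pfg]] := free_resolution AN (ex_intro _ c Mc) Mfg.
have [[a Pa] Pproj [q qq]] := PM.
have Pnull v : b < `|v| -> null_at P M v /\ null_at P (stalk A^o) v.
  by move=> bv; apply: null_at_dsum; apply/(RHom_homology_eq0 _ _ PM)/RHomb.
have Pex v : `|c| + 1 <= v -> exact_at P v.
  by move=> cv; apply: (exact_at_quasi_iso qq); apply/homology_eq0/Mc; lia.
have PA i : `|b| < i -> ext_vanish P A^o i.
  by move=> bi; apply/null_at_stalk; apply: (Pnull _ _).2; lia.
have PP v : `|b| < `|v| -> null_at P P v.
  move=> bv; apply: (null_at_quasi_iso (q := q)) => //; first by exists a.
  by apply: (Pnull _ _).1; lia.
have [k Pk] := eventually_splits AC Pfg Pproj (ex_intro _ a Pa) Pex PP PA.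
(* If [p <= k] the splitting descends to [p]; if [k < p] the truncation at [k] is already short
   enough. *)
have resolve p : (forall i, p < i -> ext_vanish P A^o i) ->
    exists P', [/\ is_proj_resolution P' M, forall v, p < v -> is_zero (P' v)
      & forall v, is_zero (P v) -> is_zero (P' v)].
  move=> pE; have [pk|/ltW kp] := leP p k.
    exact: splits_at_resolution PM (splits_at_descend PM Pfg Pk pE pk).
  have [P' [P'M P'0 PP']] := splits_at_resolution PM Pk.
  by exists P'; split=> // v pv; apply: P'0; lia.
have RHomE v : is_zero (homology (RHom M (stalk A^o)) v) <-> ext_vanish P A^o (- v).
  by rewrite (RHom_homology_eq0 _ _ PM) -null_at_stalk opprK.
have [[p0 Ep0]|noE] := pselect (exists i, ~ ext_vanish P A^o i); last first.
  have PE i : ext_vanish P A^o i by apply: contrapT => nE; apply: noE; exists i.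
  (* With no cohomology at all, truncating at [a - 1] meets the vanishing of [P] below [a], and the
     zero complex resolves [M]: both sides are [-oo]. *)
  have [P' [P'M P'0 PP']] := resolve (a - 1) (fun i _ => PE i).
  rewrite inf_homology_zero => [|v]; last by apply/RHomE.
  rewrite (pd_zero P'M) // => v.
  by have [va|av] := ltP v a; [apply/PP'/Pa | apply: P'0; lia].
(* Here [p] is the top degree in which Hom([P], [A]) has nonzero cohomology. *)
have [|p Ep pmax] := @int_max [set i | ~ ext_vanish P A^o i]%classic `|b|
  (ex_intro _ p0 Ep0).
  by move=> i nE; rewrite leNgt; apply/negP => /PA.
have pE i : p < i -> ext_vanish P A^o i.
  by move=> pi; apply: contrapT => /pmax; rewrite leNgt pi.
have RHomp : ~ is_zero (homology (RHom M (stalk A^o)) (- p)).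
  by rewrite RHomE opprK.
have -> : inf_homology (RHom M (stalk A^o)) = (- p)%:E.
  by apply: inf_homology_min => // v vp; apply/RHomE/pE; lia.
have [P' [P'M P'0 _]] := resolve p pE.
rewrite (@pd_max _ _ p) //; last by exists P'.
by rewrite EFinN oppeK ltry.
Qed.
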